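(* Let $X\in\mathcal{M}_g$ be a closed hyperbolic surface of genus $g$. There exists a constant $C_X>0$ (depending only on $X$) such that for all $\varepsilon$ with $0<\varepsilon\leq\frac12$ there exists a closed geodesic $\gamma_\varepsilon$ on $X$ that is $\varepsilon$-dense on $X$ and such that $$i(\gamma_\varepsilon,\gamma_\varepsilon)\leq C_X\,\frac{1}{\varepsilon^2}\left(\log\left(\frac1\varepsilon\right)\right)^2.$$
   Context: $\mathcal{M}_g$ is the moduli space of closed orientable hyperbolic surfaces of genus $g\geq 2$. Closed geodesics are not required to be simple. A closed geodesic $\gamma$ on $X$ is $\varepsilon$-dense on $X$ if $d_X(x,\gamma)\leq\varepsilon$ for all $x\in X$, where $d_X$ is the hyperbolic distance on $X$. $i(\gamma,\gamma)$ denotes the self-intersection number of $\gamma$. *)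

(* Defs.v *)
From Stdlib Require Import Reals List.
From Coquelicot Require Import Coquelicot.
Import ListNotations.
Open Scope R_scope.

(** A closed hyperbolic surface is [X = G \ H], where [H] is the upper half
    plane [{z : C | 0 < Im z}] and [G] is a discrete subgroup of PSL(2,R), given
    by its full preimage in SL(2,R).  Points of [X] are written as points
    of [H], equality in [X] being the relation [same_point] below. *)

(** * The hyperbolic plane and its orientation-preserving isometries *)

Definition in_H (z : C) : Prop := 0 < Im z.

(** sinh (d(z,w) / 2) = |z - w| / (2 sqrt (Im z Im w)) *)
Definition dist_H (z w : C) : R :=
  2 * arcsinh (Cmod (z - w)%C / (2 * sqrt (Im z * Im w))).

Record mat2 := Mat2 { m11 : R; m12 : R; m21 : R; m22 : R }.

Definition mat_det (A : mat2) : R := m11 A * m22 A - m12 A * m21 A.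

Definition mat_one : mat2 := Mat2 1 0 0 1.

Definition mat_opp (A : mat2) : mat2 :=
  Mat2 (- m11 A) (- m12 A) (- m21 A) (- m22 A).

Definition mat_mul (A B : mat2) : mat2 :=
  Mat2 (m11 A * m11 B + m12 A * m21 B) (m11 A * m12 B + m12 A * m22 B)
       (m21 A * m11 B + m22 A * m21 B) (m21 A * m12 B + m22 A * m22 B).

(** The inverse for matrices of determinant 1. *)
Definition mat_inv (A : mat2) : mat2 :=
  Mat2 (m22 A) (- m12 A) (- m21 A) (m11 A).

Definition eq_PSL (A B : mat2) : Prop := A = B \/ A = mat_opp B.

Definition mobius (A : mat2) (z : C) : C :=
  ((m11 A * z + m12 A) / (m21 A * z + m22 A))%C.

(** * The quotient and its metric *)

Definition same_point (G : mat2 -> Prop) (z w : C) : Prop :=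
  exists A, G A /\ w = mobius A z.

Definition dist_X (G : mat2 -> Prop) (z w : C) : R :=
  real (Glb_Rbar (fun r => exists A, G A /\ r = dist_H z (mobius A w))).

Definition subgroup_PSL (G : mat2 -> Prop) : Prop :=
  (forall A, G A -> mat_det A = 1) /\
  G mat_one /\ G (mat_opp mat_one) /\
  (forall A B, G A -> G B -> G (mat_mul A B)) /\
  (forall A, G A -> G (mat_inv A)).

Definition discrete (G : mat2 -> Prop) : Prop :=
  exists delta, 0 < delta /\
    forall A, G A ->
      Rabs (m11 A - 1) < delta -> Rabs (m12 A) < delta ->
      Rabs (m21 A) < delta -> Rabs (m22 A - 1) < delta ->
      A = mat_one.

Definition acts_freely (G : mat2 -> Prop) : Prop :=
  forall A z, G A -> in_H z -> mobius A z = z -> eq_PSL A mat_one.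

(** Sequential compactness of the metric space [X]. *)
Definition compact_quotient (G : mat2 -> Prop) : Prop :=
  forall u : nat -> C, (forall n, in_H (u n)) ->
    exists (phi : nat -> nat) (z : C),
      (forall m n, (m < n)%nat -> (phi m < phi n)%nat) /\ in_H z /\
      is_lim_seq (fun n => dist_X G (u (phi n)) z) 0.

(** * Genus

    [G] has genus [g] when it is isomorphic to the fundamental group
    < a_0, b_0, ..., a_{g-1}, b_{g-1} | [a_0, b_0] ... [a_{g-1}, b_{g-1}] >
    of the closed orientable surface of genus [g]. *)

Inductive surface_gen := gen_a (i : nat) | gen_b (i : nat).

Definition gen_index (x : surface_gen) : nat :=
  match x with gen_a i => i | gen_b i => i end.

(** [(x, true)] is the letter x and [(x, false)] is its inverse. *)
Definition word := list (surface_gen * bool).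

Definition word_over (g : nat) (w : word) : Prop :=
  List.Forall (fun l => (gen_index (fst l) < g)%nat) w.

Definition surface_relator (g : nat) : word :=
  flat_map (fun i => [(gen_a i, true); (gen_b i, true);
                      (gen_a i, false); (gen_b i, false)]) (seq 0 g).

(** Equality in the presented group. *)
Inductive surface_eq (g : nat) : word -> word -> Prop :=
| surface_eq_refl w : surface_eq g w w
| surface_eq_sym w w' : surface_eq g w w' -> surface_eq g w' w
| surface_eq_trans w w' w'' :
    surface_eq g w w' -> surface_eq g w' w'' -> surface_eq g w w''
| surface_eq_cancel u v x s : (gen_index x < g)%nat ->
    surface_eq g (u ++ [(x, s); (x, negb s)] ++ v) (u ++ v)
| surface_eq_relator u v :
    surface_eq g (u ++ surface_relator g ++ v) (u ++ v).

Definition word_eval (rho : surface_gen -> mat2) (w : word) : mat2 :=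
  fold_right
    (fun (l : surface_gen * bool) M => mat_mul (if snd l then rho (fst l) else mat_inv (rho (fst l))) M)
    mat_one w.

Definition has_genus (G : mat2 -> Prop) (g : nat) : Prop :=
  exists rho : surface_gen -> mat2,
    (forall x, (gen_index x < g)%nat -> G (rho x)) /\
    (forall A, G A -> exists w, word_over g w /\ eq_PSL (word_eval rho w) A) /\
    (forall w, word_over g w ->
       (eq_PSL (word_eval rho w) mat_one <-> surface_eq g w [])).

Definition closed_hyperbolic_surface (g : nat) (G : mat2 -> Prop) : Prop :=
  subgroup_PSL G /\ discrete G /\ acts_freely G /\ compact_quotient G /\
  has_genus G g.

(** * Closed geodesics *)

(** A closed geodesic of [X], parametrized by arc length on [R / L Z], is given
    by a lift [c] to [H]: a complete unit-speed geodesic of [H] whose projection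
    to [X] is [L]-periodic. *)
Definition closed_geodesic (G : mat2 -> Prop) (c : R -> C) (L : R) : Prop :=
  (forall t, in_H (c t)) /\
  (forall s t, dist_H (c s) (c t) = Rabs (s - t)) /\
  0 < L /\
  (forall t, same_point G (c (t + L)) (c t)).

Definition dist_X_geodesic (G : mat2 -> Prop) (x : C) (c : R -> C) : R :=
  real (Glb_Rbar (fun r => exists t, r = dist_X G x (c t))).

Definition dense_geodesic (G : mat2 -> Prop) (eps : R) (c : R -> C) : Prop :=
  forall x, in_H x -> dist_X_geodesic G x c <= eps.

(** Self-intersections are counted with multiplicity, as pairs of distinct
    parameters in [R / L Z] with the same image in [X] (a point through which
    k strands pass contributes k (k - 1) / 2).  Distinct strands of a primitive
    closed geodesic always cross transversally.  A geodesic running several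
    times around a shorter one has infinitely many such pairs, hence has no
    finite self-intersection number in this sense. *)
Definition self_intersection (G : mat2 -> Prop) (c : R -> C) (L : R)
    (p : R * R) : Prop :=
  0 <= fst p /\ fst p < snd p /\ snd p < L /\
  same_point G (c (fst p)) (c (snd p)).

Definition self_intersection_number (G : mat2 -> Prop) (c : R -> C) (L : R)
    (n : nat) : Prop :=
  exists l : list (R * R),
    NoDup l /\ length l = n /\ (forall p, In p l <-> self_intersection G c L p).

(* Main.v *)
(** Let [l = log (1 / eps)].  By cocompactness it is enough to pass [eps]-close to every point
    of a compact box, hence to follow about [1 / eps] vertical segments, of equally spaced
    abscissae [a_j].  For each [a_j] there is an element [g_j] of the group, of norm polynomial in
    [1 / eps], that sends the complement of an [eps]-neighbourhood of [a_j] on the boundary circle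
    into an [eps]-neighbourhood of infinity.  By ping-pong every cyclic rotation of
    [P = g_0 g_1 ... g_n] that ends in [g_j] has its repelling fixed point near [a_j] and its
    attracting one near infinity; so its axis, a translate of the axis of [P], follows the
    [j]-th segment, and the closed geodesic of [P] is [eps]-dense.  Its length is at
    most [2 log |P| = O (l / eps)].

    On a closed geodesic parametrized by its minimal period [L], two strands much shorter than
    the injectivity radius meet at most once, whence [O (L^2)] self-intersections. *)

Require Import Defs.
From Stdlib Require Import Reals List Lra Lia Psatz Classical ZArith IndefiniteDescription.
From Coquelicot Require Import Coquelicot.
Import ListNotations.
Open Scope R_scope.

(** The delicate point is the existence of the $g_j$. Cocompactness brings the two far ends of a
    segment back to a box, but the element joining them need not send the right directions to the
    right places. A correction of bounded norm repairs this; it exists uniformly because no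
    direction of the plane is fixed by all of [G] and the projective line is compact. Boundary
    points are written as nonzero vectors of R^2, on which SL(2,R) acts linearly: infinity is then
    no special case, closeness of directions is a small [wedge], and fixed points of a product are
    its eigenvectors. Estimates in H go through the invariant rational function [sep], so that
    polynomial inequalities take the place of the triangle inequality. Nothing makes $P$ primitive
    in [G], and running several times around a geodesic would give infinitely many pairs to count.
    The smallest period of the axis is therefore used: it leaves the image, hence density, unchanged
    and only shortens the curve. *)

(** * Counting by keys and cells *)

(** Pigeonhole, with a classical choice of at most one element per key. It serves twice: for group
    elements of bounded norm, and for the self-intersections. *)
Lemma finite_by_key {X K : Type} (f : X -> K) (ks : list K) :
  forall P : X -> Prop,
    (forall x, P x -> In (f x) ks) ->
    (forall x y, P x -> P y -> f x = f y -> x = y) ->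
    exists l, NoDup l /\ (forall x, In x l <-> P x) /\ (length l <= length ks)%nat.
Proof.
  induction ks as [|k ks IH]; intros P Hin Hinj.
  - exists []; repeat split; simpl; try constructor; try tauto; try lia.
    intros Hx; exact (Hin x Hx).
  - destruct (IH (fun x => P x /\ f x <> k)) as (l & Hnd & Hl & Hlen).
    + intros x [Hx Hk]. destruct (Hin x Hx) as [E|E]; [now subst|exact E].
    + intros x y [Hx _] [Hy _]; now apply Hinj.
    + destruct (classic (exists x, P x /\ f x = k)) as [(x0 & Hx0 & Hk0)|Hno].
      * exists (x0 :: l); split; [|split; [|simpl; lia]].
        -- constructor; [|exact Hnd]. rewrite Hl; tauto.
        -- intros x; simpl; rewrite Hl; split.
           ++ intros [<-|[H _]]; assumption.
           ++ intros Hx. destruct (classic (f x = k)) as [E|E]; [left|right; tauto].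
              apply Hinj; congruence.
      * exists l; split; [exact Hnd|split; [|simpl; lia]].
        intros x; rewrite Hl; split; [tauto|].
        intros Hx; split; [exact Hx|intros E; apply Hno; now exists x].
Qed.

Definition cell (x : R) : nat := Z.to_nat (Int_part x).

Lemma cell_bounds x : 0 <= x -> INR (cell x) <= x < INR (cell x) + 1.
Proof.
  intros Hx. destruct (base_Int_part x) as [H1 H2].
  assert (0 <= Int_part x)%Z.
  { assert (-1 < Int_part x)%Z; [|lia]. apply lt_IZR. lra. }
  unfold cell. rewrite INR_IZR_INZ, Z2Nat.id by assumption. lra.
Qed.

Lemma cell_in_seq x n : 0 <= x < INR n -> In (cell x) (seq 0 n).
Proof.
  intros [H1 H2]. apply in_seq. split; [lia|]. simpl.
  apply INR_lt. destruct (cell_bounds x H1). lra.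
Qed.

Lemma cell_close x y : 0 <= x -> 0 <= y -> cell x = cell y -> Rabs (x - y) < 1.
Proof.
  intros Hx Hy E. pose proof (cell_bounds x Hx). pose proof (cell_bounds y Hy).
  rewrite E in *. apply Rabs_def1; lra.
Qed.

(** * Algebra of real two by two matrices *)

Lemma mat_ext A B : m11 A = m11 B -> m12 A = m12 B -> m21 A = m21 B -> m22 A = m22 B -> A = B.
Proof. destruct A, B; simpl; intros; now subst. Qed.

Ltac mat_solve := apply mat_ext; simpl; try ring.

Lemma mat_mul_assoc A B D : mat_mul A (mat_mul B D) = mat_mul (mat_mul A B) D.
Proof. mat_solve. Qed.

Lemma mat_mul_1_l A : mat_mul mat_one A = A.
Proof. mat_solve. Qed.

Lemma mat_mul_1_r A : mat_mul A mat_one = A.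
Proof. mat_solve. Qed.

Lemma mat_det_mul A B : mat_det (mat_mul A B) = mat_det A * mat_det B.
Proof. unfold mat_det; simpl; ring. Qed.

Lemma mat_det_inv A : mat_det (mat_inv A) = mat_det A.
Proof. unfold mat_det; simpl; ring. Qed.

Lemma mat_inv_l A : mat_det A = 1 -> mat_mul (mat_inv A) A = mat_one.
Proof. unfold mat_det; intros H; mat_solve; lra. Qed.

Lemma mat_inv_r A : mat_det A = 1 -> mat_mul A (mat_inv A) = mat_one.
Proof. unfold mat_det; intros H; mat_solve; lra. Qed.

Lemma mat_inv_mul_l A B : mat_det A = 1 -> mat_mul (mat_inv A) (mat_mul A B) = B.
Proof. intros H; now rewrite mat_mul_assoc, mat_inv_l, mat_mul_1_l. Qed.

Lemma mat_mul_inv_l A B : mat_det A = 1 -> mat_mul A (mat_mul (mat_inv A) B) = B.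
Proof. intros H; now rewrite mat_mul_assoc, mat_inv_r, mat_mul_1_l. Qed.

Lemma mat_inv_mul A B : mat_inv (mat_mul A B) = mat_mul (mat_inv B) (mat_inv A).
Proof. mat_solve. Qed.

Lemma mat_inv_inv A : mat_inv (mat_inv A) = A.
Proof. mat_solve. Qed.

Definition mat_tr (A : mat2) : R := m11 A + m22 A.

Definition mat_norm (A : mat2) : R :=
  Rabs (m11 A) + Rabs (m12 A) + Rabs (m21 A) + Rabs (m22 A).

Lemma mat_norm_pos A : 0 <= mat_norm A.
Proof.
  unfold mat_norm. pose proof (Rabs_pos (m11 A)); pose proof (Rabs_pos (m12 A));
  pose proof (Rabs_pos (m21 A)); pose proof (Rabs_pos (m22 A)); lra.
Qed.

Lemma mat_norm_entries A :
  Rabs (m11 A) <= mat_norm A /\ Rabs (m12 A) <= mat_norm A /\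
  Rabs (m21 A) <= mat_norm A /\ Rabs (m22 A) <= mat_norm A.
Proof.
  unfold mat_norm. pose proof (Rabs_pos (m11 A)); pose proof (Rabs_pos (m12 A));
  pose proof (Rabs_pos (m21 A)); pose proof (Rabs_pos (m22 A)); lra.
Qed.

Lemma mat_norm_inv A : mat_norm (mat_inv A) = mat_norm A.
Proof. unfold mat_norm; simpl. rewrite !Rabs_Ropp. ring. Qed.

Lemma mat_norm_mul A B : mat_norm (mat_mul A B) <= mat_norm A * mat_norm B.
Proof.
  unfold mat_norm; simpl.
  assert (T : forall a b c d, Rabs (a * b + c * d) <= Rabs a * Rabs b + Rabs c * Rabs d).
  { intros. rewrite <- !Rabs_mult. apply Rabs_triang. }
  pose proof (T (m11 A) (m11 B) (m12 A) (m21 B)).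
  pose proof (T (m11 A) (m12 B) (m12 A) (m22 B)).
  pose proof (T (m21 A) (m11 B) (m22 A) (m21 B)).
  pose proof (T (m21 A) (m12 B) (m22 A) (m22 B)).
  pose proof (Rabs_pos (m11 A)); pose proof (Rabs_pos (m12 A));
  pose proof (Rabs_pos (m21 A)); pose proof (Rabs_pos (m22 A)).
  pose proof (Rabs_pos (m11 B)); pose proof (Rabs_pos (m12 B));
  pose proof (Rabs_pos (m21 B)); pose proof (Rabs_pos (m22 B)).
  generalize dependent (Rabs (m11 A)); generalize dependent (Rabs (m12 A));
  generalize dependent (Rabs (m21 A)); generalize dependent (Rabs (m22 A)).
  intros; nra.
Qed.

(** * The hyperbolic plane *)

Lemma C_ext (z w : C) : Re z = Re w -> Im z = Im w -> z = w.
Proof. destruct z, w; simpl; intros; now subst. Qed.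

(** The squared modulus of the automorphy factor c z + d, in real coordinates. *)
Definition auto_factor (A : mat2) (z : C) : R :=
  (m21 A * Re z + m22 A) ^ 2 + (m21 A * Im z) ^ 2.

Lemma auto_factor_pos A z : mat_det A = 1 -> in_H z -> 0 < auto_factor A z.
Proof.
  unfold mat_det, in_H, auto_factor. intros HA Hz.
  destruct (Req_dec (m21 A) 0) as [E|E].
  - rewrite E in *. assert (m22 A <> 0) by (intros E'; rewrite E' in HA; lra).
    pose proof (pow2_gt_0 _ H). nra.
  - assert (0 < (m21 A * Im z) ^ 2) by (apply pow2_gt_0; apply Rmult_integral_contrapositive; split; lra).
    pose proof (pow2_ge_0 (m21 A * Re z + m22 A)). lra.
Qed.

Lemma mobius_Re A z : mat_det A = 1 -> in_H z ->
  Re (mobius A z) =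
  ((m11 A * Re z + m12 A) * (m21 A * Re z + m22 A) + m11 A * m21 A * Im z ^ 2) / auto_factor A z.
Proof.
  intros HA Hz. pose proof (auto_factor_pos A z HA Hz) as Hp.
  unfold auto_factor in *. destruct z as [x y]; simpl in *.
  field. intros H; nra.
Qed.

Lemma mobius_Im A z : mat_det A = 1 -> in_H z ->
  Im (mobius A z) = Im z / auto_factor A z.
Proof.
  intros HA Hz. pose proof (auto_factor_pos A z HA Hz) as Hp.
  transitivity (Im z * mat_det A / auto_factor A z); [|rewrite HA; f_equal; ring].
  unfold auto_factor, mat_det in *. destruct z as [x y]; simpl in *.
  field. intros H; nra.
Qed.

Lemma mobius_in_H A z : mat_det A = 1 -> in_H z -> in_H (mobius A z).
Proof.
  intros HA Hz. unfold in_H. rewrite mobius_Im by assumption.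
  apply Rdiv_lt_0_compat; [exact Hz | now apply auto_factor_pos].
Qed.

Lemma Cmod_sqr (z : C) : Cmod z ^ 2 = Re z ^ 2 + Im z ^ 2.
Proof. unfold Cmod, Re, Im. rewrite pow2_sqrt; [reflexivity|nra]. Qed.

Lemma Cmod_auto_factor A z : Cmod (m21 A * z + m22 A)%C ^ 2 = auto_factor A z.
Proof. rewrite Cmod_sqr. unfold auto_factor; destruct z; simpl; ring. Qed.

Lemma mobius_den_neq_0 A z : mat_det A = 1 -> in_H z -> (m21 A * z + m22 A)%C <> 0%C.
Proof.
  intros HA Hz E. pose proof (auto_factor_pos A z HA Hz) as Hp.
  rewrite <- Cmod_auto_factor, E, Cmod_0 in Hp. lra.
Qed.

Lemma mobius_mul A B z : mat_det A = 1 -> mat_det B = 1 -> in_H z ->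
  mobius (mat_mul A B) z = mobius A (mobius B z).
Proof.
  intros HA HB Hz.
  pose proof (mobius_den_neq_0 B z HB Hz) as D1.
  pose proof (mobius_den_neq_0 A _ HA (mobius_in_H B z HB Hz)) as D2.
  assert (HAB : mat_det (mat_mul A B) = 1) by (rewrite mat_det_mul, HA, HB; ring).
  pose proof (mobius_den_neq_0 _ z HAB Hz) as D3.
  unfold mobius in *; simpl in *. rewrite ?RtoC_plus, ?RtoC_mult in *.
  field. repeat split; try assumption.
  intros E; apply D3. rewrite <- E. ring.
Qed.

Lemma mobius_one z : mobius mat_one z = z.
Proof. unfold mobius; simpl. field. Qed.

Lemma mobius_opp A z : mat_det A = 1 -> in_H z -> mobius (mat_opp A) z = mobius A z.
Proof.
  intros HA Hz. pose proof (mobius_den_neq_0 A z HA Hz) as D.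
  unfold mobius; simpl. rewrite !RtoC_opp. field. split; [exact D|].
  intros E; apply D. apply C_ext; apply (f_equal Re) in E as E1; apply (f_equal Im) in E as E2;
    destruct z; simpl in *; lra.
Qed.

Lemma mobius_inv_l A z : mat_det A = 1 -> in_H z -> mobius (mat_inv A) (mobius A z) = z.
Proof.
  intros HA Hz. rewrite <- mobius_mul, mat_inv_l, mobius_one; auto.
  now rewrite mat_det_inv.
Qed.

Lemma mobius_inv_r A z : mat_det A = 1 -> in_H z -> mobius A (mobius (mat_inv A) z) = z.
Proof.
  intros HA Hz. rewrite <- mobius_mul, mat_inv_r, mobius_one; auto.
  now rewrite mat_det_inv.
Qed.

(** [sep z w] is [4 sinh^2 (d (z, w) / 2)]. *)
Definition sep (z w : C) : R := Cmod (z - w)%C ^ 2 / (Im z * Im w).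

Lemma sep_coord z w : sep z w = ((Re z - Re w) ^ 2 + (Im z - Im w) ^ 2) / (Im z * Im w).
Proof. unfold sep. rewrite Cmod_sqr. reflexivity. Qed.

Lemma sep_sym z w : sep z w = sep w z.
Proof. rewrite !sep_coord. f_equal; ring. Qed.

Lemma mobius_sub A z w : mat_det A = 1 -> in_H z -> in_H w ->
  (mobius A z - mobius A w)%C =
  ((z - w) / ((m21 A * z + m22 A) * (m21 A * w + m22 A)))%C.
Proof.
  intros HA Hz Hw.
  pose proof (mobius_den_neq_0 A z HA Hz) as D1.
  pose proof (mobius_den_neq_0 A w HA Hw) as D2.
  replace (z - w)%C with ((z - w) * RtoC (mat_det A))%C by (rewrite HA; apply Cmult_1_r).
  unfold mobius, mat_det. rewrite RtoC_minus, !RtoC_mult. field. now split.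
Qed.

Lemma sep_mobius A z w : mat_det A = 1 -> in_H z -> in_H w ->
  sep (mobius A z) (mobius A w) = sep z w.
Proof.
  intros HA Hz Hw.
  pose proof (mobius_den_neq_0 A z HA Hz) as D1.
  pose proof (mobius_den_neq_0 A w HA Hw) as D2.
  pose proof (auto_factor_pos A z HA Hz). pose proof (auto_factor_pos A w HA Hw).
  unfold sep. rewrite mobius_sub by assumption.
  rewrite Cmod_div by (now apply Cmult_neq_0).
  rewrite Cmod_mult, !mobius_Im by assumption.
  unfold Rdiv at 2. rewrite Rpow_mult_distr, pow_inv, Rpow_mult_distr, !Cmod_auto_factor.
  unfold in_H in *. field. repeat split; lra.
Qed.

Lemma dist_H_sep z w : in_H z -> in_H w -> dist_H z w = 2 * arcsinh (sqrt (sep z w) / 2).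
Proof.
  intros Hz Hw. unfold dist_H, sep. f_equal. f_equal.
  assert (0 < Im z * Im w) by (now apply Rmult_lt_0_compat).
  rewrite sqrt_div by (try apply pow2_ge_0; assumption).
  rewrite sqrt_pow2 by apply Cmod_ge_0. field.
  apply Rgt_not_eq. now apply sqrt_lt_R0.
Qed.

Lemma dist_H_mobius A z w : mat_det A = 1 -> in_H z -> in_H w ->
  dist_H (mobius A z) (mobius A w) = dist_H z w.
Proof.
  intros HA Hz Hw. rewrite !dist_H_sep by auto using mobius_in_H.
  now rewrite sep_mobius.
Qed.

Lemma dist_H_nonneg z w : in_H z -> in_H w -> 0 <= dist_H z w.
Proof.
  intros Hz Hw. rewrite dist_H_sep by assumption.
  pose proof (sqrt_pos (sep z w)).
  pose proof (arcsinh_le 0 (sqrt (sep z w) / 2)). rewrite arcsinh_0 in H0. lra.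
Qed.

Lemma arcsinh_le_self x : 0 <= x -> arcsinh x <= x.
Proof.
  intros Hx. rewrite <- (arcsinh_sinh x) at 2. apply arcsinh_le.
  destruct Hx as [Hx|<-]; [|rewrite sinh_0; lra].
  destruct (MVT_cor2 sinh cosh 0 x Hx) as (c & Hc & Hc').
  - intros; apply derivable_pt_lim_sinh.
  - rewrite sinh_0 in Hc.
    assert (1 <= cosh c).
    { unfold cosh. pose proof (exp_pos c). pose proof (exp_pos (- c)).
      assert (exp c * exp (- c) = 1) by (rewrite <- exp_plus, Rplus_opp_r; apply exp_0).
      pose proof (pow2_ge_0 (exp c - exp (- c))). nra. }
    nra.
Qed.

(** As arcsinh x <= x, the passage from [sep] to the distance loses no constant. The density
    estimate is converted in this way at the end. *)
Lemma dist_H_le_of_sep z w e : in_H z -> in_H w -> 0 <= e -> sep z w <= e ^ 2 -> dist_H z w <= e.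
Proof.
  intros Hz Hw He H. rewrite dist_H_sep by assumption.
  assert (sqrt (sep z w) <= e).
  { rewrite <- (sqrt_pow2 e) by assumption. now apply sqrt_le_1_alt. }
  pose proof (sqrt_pos (sep z w)).
  pose proof (arcsinh_le_self (sqrt (sep z w) / 2)). lra.
Qed.

Lemma sep_lt_of_dist_H z w r : in_H z -> in_H w -> 0 < r ->
  dist_H z w < 2 * arcsinh (sqrt r / 2) -> sep z w < r.
Proof.
  intros Hz Hw Hr H. rewrite dist_H_sep in H by assumption.
  destruct (Rlt_le_dec (sep z w) r) as [|L]; [assumption|exfalso].
  apply sqrt_le_1_alt in L. pose proof (arcsinh_le (sqrt r / 2) (sqrt (sep z w) / 2)). lra.
Qed.

(** The denominator c z + d of z - A z cancels against the one in Im (A z). What remains is the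
    quadratic polynomial whose zeros are the fixed points of A. *)
Lemma sep_displacement A z : mat_det A = 1 -> in_H z ->
  sep z (mobius A z) =
  Cmod (m21 A * z * z + (m22 A - m11 A) * z - m12 A)%C ^ 2 / Im z ^ 2.
Proof.
  intros HA Hz.
  pose proof (mobius_den_neq_0 A z HA Hz) as D.
  pose proof (auto_factor_pos A z HA Hz) as Hp.
  assert (E : (z - mobius A z)%C =
    ((m21 A * z * z + (m22 A - m11 A) * z - m12 A) / (m21 A * z + m22 A))%C)
    by (unfold mobius; field; exact D).
  unfold sep. rewrite E, Cmod_div by exact D.
  rewrite mobius_Im by assumption.
  unfold Rdiv at 2. rewrite Rpow_mult_distr, pow_inv, Cmod_auto_factor.
  unfold in_H in *. field. split; lra.
Qed.

Lemma sep_displacement_coord A z : mat_det A = 1 -> in_H z ->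
  sep z (mobius A z) =
  ((m21 A * (Re z ^ 2 - Im z ^ 2) + (m22 A - m11 A) * Re z - m12 A) ^ 2
   + Im z ^ 2 * (2 * m21 A * Re z + m22 A - m11 A) ^ 2) / Im z ^ 2.
Proof.
  intros HA Hz. rewrite sep_displacement by assumption. rewrite Cmod_sqr.
  f_equal. destruct z; simpl; ring.
Qed.

(** * The group and the quotient metric *)

(** [real] sends infinite values to 0; the lower bound 0 and the member [r] make the infimum
    finite. *)
Lemma Glb_le (E : R -> Prop) r : (forall s, E s -> 0 <= s) -> E r -> real (Glb_Rbar E) <= r.
Proof.
  intros H0 Hr. destruct (Glb_Rbar_correct E) as [H1 H2].
  specialize (H1 r Hr). specialize (H2 (Finite 0) (fun s Hs => H0 s Hs)).
  destruct (Glb_Rbar E); simpl in *; [assumption|contradiction|contradiction].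
Qed.

(** The member [r0] excludes the empty set, whose infimum +oo is read as 0 by [real]. *)
Lemma Glb_lt (E : R -> Prop) r0 e : (forall s, E s -> 0 <= s) -> E r0 ->
  real (Glb_Rbar E) < e -> exists r, E r /\ r < e.
Proof.
  intros H0 Hr0 He. apply NNPP; intros Hno.
  destruct (Glb_Rbar_correct E) as [H1 H2]. specialize (H1 r0 Hr0).
  assert (Hb : is_lb_Rbar E (Finite e)).
  { intros s Hs; simpl. apply Rnot_lt_le; intros L; apply Hno; now exists s. }
  specialize (H2 _ Hb). destruct (Glb_Rbar E); simpl in *; [lra|contradiction|contradiction].
Qed.

Section SubgroupFacts.
Context (G : mat2 -> Prop) (HG : subgroup_PSL G).

Lemma G_det A : G A -> mat_det A = 1.
Proof. apply HG. Qed.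

Lemma G_one : G mat_one.
Proof. apply HG. Qed.

Lemma G_mul A B : G A -> G B -> G (mat_mul A B).
Proof. apply HG. Qed.

Lemma G_inv A : G A -> G (mat_inv A).
Proof. apply HG. Qed.

Lemma G_opp A : G A -> G (mat_opp A).
Proof.
  intros H. replace (mat_opp A) with (mat_mul (mat_opp mat_one) A) by mat_solve.
  apply G_mul; [apply HG|exact H].
Qed.

Lemma dist_X_le z w A : in_H z -> in_H w -> G A -> dist_X G z w <= dist_H z (mobius A w).
Proof.
  intros Hz Hw HA. apply Glb_le; [|now exists A].
  intros s (B & HB & ->). apply dist_H_nonneg; auto using mobius_in_H, G_det.
Qed.

Lemma dist_X_nonneg z w : in_H z -> in_H w -> 0 <= dist_X G z w.
Proof.
  intros Hz Hw. apply Rnot_lt_le; intros L.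
  apply Glb_lt with (r0 := dist_H z (mobius mat_one w)) in L as (r & (A & HA & ->) & Hr).
  - pose proof (dist_H_nonneg z (mobius A w) Hz (mobius_in_H A w (G_det A HA) Hw)). lra.
  - intros s (B & HB & ->). apply dist_H_nonneg; auto using mobius_in_H, G_det.
  - exists mat_one; split; [apply G_one|reflexivity].
Qed.

Lemma dist_X_lt z w e : in_H z -> in_H w -> dist_X G z w < e ->
  exists A, G A /\ dist_H z (mobius A w) < e.
Proof.
  intros Hz Hw L.
  apply Glb_lt with (r0 := dist_H z (mobius mat_one w)) in L as (r & (A & HA & ->) & Hr).
  - now exists A.
  - intros s (B & HB & ->). apply dist_H_nonneg; auto using mobius_in_H, G_det.
  - exists mat_one; split; [apply G_one|reflexivity].
Qed.

(** Compactness speaks of an infimum over [G]; strict inequality extracts an actual group element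
    realizing the closeness, which is the form used in all arguments by contradiction below. *)
Lemma compact_subsequence (u : nat -> C) :
  compact_quotient G -> (forall n, in_H (u n)) ->
  exists z, in_H z /\ forall r, 0 < r -> forall N, exists n A,
    (N <= n)%nat /\ G A /\ sep (u n) (mobius A z) < r.
Proof.
  intros HC Hu. destruct (HC u Hu) as (phi & z & Hphi & Hz & Hlim).
  exists z; split; [exact Hz|]. intros r Hr N.
  assert (Hr' : 0 < 2 * arcsinh (sqrt r / 2)).
  { pose proof (arcsinh_lt 0 (sqrt r / 2)). rewrite arcsinh_0 in H.
    pose proof (sqrt_lt_R0 r Hr). lra. }
  apply is_lim_seq_spec in Hlim. destruct (Hlim (mkposreal _ Hr')) as [N' HN'].
  simpl in HN'. specialize (HN' (max N N') (Nat.le_max_r _ _)).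
  rewrite Rminus_0_r in HN'. apply Rle_lt_trans with (1 := Rle_abs _) in HN'.
  apply dist_X_lt in HN' as (A & HA & HAd); auto.
  exists (phi (max N N')), A. repeat split; auto.
  - assert (forall n, (n <= phi n)%nat).
    { induction n; [lia|]. specialize (Hphi n (S n)). lia. }
    specialize (H (max N N')). lia.
  - apply sep_lt_of_dist_H; auto using mobius_in_H, G_det.
Qed.

(** Discreteness is given only at the identity. Two elements whose entries lie in the same small
    cells have A^-1 B near the identity, hence coincide, and there are finitely many cells. *)
Lemma discrete_bounded_finite M : discrete G -> 0 <= M ->
  exists l, forall A, G A -> mat_norm A <= M -> In A l.
Proof.
  intros (d & Hd & HD) HM.
  (* Each entry of A^-1 B - 1 is a sum of two products of an entry of A with a difference of
     entries, so it is below 2 M e < d. *)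
  set (e := d / (2 * M + 1)).
  assert (He : 0 < e) by (apply Rdiv_lt_0_compat; lra).
  assert (Hed : 2 * M * e < d).
  { replace d with ((2 * M + 1) * e) by (unfold e; field; lra). lra. }
  destruct (INR_unbounded (2 * M / e)) as [K HK].
  set (key := fun x => cell ((x + M) / e)).
  set (s := seq 0 K).
  assert (Hkey : forall x, Rabs x <= M -> In (key x) s).
  { intros x Hx. apply Rabs_le_between in Hx. apply cell_in_seq. split.
    - apply Rdiv_le_0_compat; lra.
    - apply Rle_lt_trans with (2 := HK). apply Rmult_le_compat_r; [|lra].
      left; now apply Rinv_0_lt_compat. }
  assert (Hclose : forall x y, Rabs x <= M -> Rabs y <= M -> key x = key y -> Rabs (y - x) < e).
  { intros x y Hx Hy Exy. apply Rabs_le_between in Hx, Hy. symmetry in Exy.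
    apply cell_close in Exy; try (apply Rdiv_le_0_compat; lra).
    replace ((y + M) / e - (x + M) / e) with ((y - x) / e) in Exy by (field; lra).
    unfold Rdiv in Exy. rewrite Rabs_mult, (Rabs_pos_eq (/ e)) in Exy
      by (left; now apply Rinv_0_lt_compat).
    apply (Rmult_lt_compat_r e) in Exy; [|exact He].
    rewrite Rmult_assoc, Rinv_l in Exy by lra. lra. }
  destruct (finite_by_key (fun A => (key (m11 A), key (m12 A), (key (m21 A), key (m22 A))))
    (list_prod (list_prod s s) (list_prod s s)) (fun A => G A /\ mat_norm A <= M))
    as (l & _ & Hl & _).
  - intros A [HA HAM]. destruct (mat_norm_entries A) as (? & ? & ? & ?).
    repeat apply in_prod; apply Hkey; lra.
  - intros A B [HA HAM] [HB HBM] E. injection E as E11 E12 E21 E22.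
    destruct (mat_norm_entries A) as (? & ? & ? & ?).
    destruct (mat_norm_entries B) as (? & ? & ? & ?).
    apply Hclose in E11, E12, E21, E22; try lra.
    assert (HAB : mat_mul (mat_inv A) B = mat_one).
    { pose proof (G_det A HA) as DA. unfold mat_det in DA.
      assert (T : forall a b x y, Rabs a <= M -> Rabs b <= M -> Rabs x < e -> Rabs y < e ->
        Rabs (a * x - b * y) < d).
      { intros a b x y Ha Hb Hx Hy. unfold Rminus.
        eapply Rle_lt_trans; [apply Rabs_triang|]. rewrite Rabs_Ropp, !Rabs_mult.
        pose proof (Rabs_pos a); pose proof (Rabs_pos b);
        pose proof (Rabs_pos x); pose proof (Rabs_pos y). nra. }
      apply HD; [now apply G_mul; [apply G_inv|]| | | |]; simpl.
      - replace (_ - 1) with (m22 A * (m11 B - m11 A) - m12 A * (m21 B - m21 A)) by lra.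
        apply T; lra.
      - replace (m22 A * m12 B + _) with (m22 A * (m12 B - m12 A) - m12 A * (m22 B - m22 A)) by ring.
        apply T; lra.
      - replace (_ + _) with (m11 A * (m21 B - m21 A) - m21 A * (m11 B - m11 A)) by ring.
        apply T; lra.
      - replace (_ - 1) with (m11 A * (m22 B - m22 A) - m21 A * (m12 B - m12 A)) by lra.
        apply T; lra. }
    rewrite <- (mat_mul_inv_l A B (G_det A HA)), HAB. now rewrite mat_mul_1_r.
  - exists l. intros A HA HAM. apply Hl. now split.
Qed.

End SubgroupFacts.

(** * Injectivity radius and cocompactness *)

(** The ratio q of the heights satisfies (q - 1)^2 < q, which confines it between 1/3 and 3. *)
Lemma sep_lt_1_bounds z w : in_H z -> in_H w -> sep z w < 1 ->
  Im z / 3 <= Im w <= 3 * Im z /\ Rabs (Re w - Re z) <= 2 * Im z.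
Proof.
  unfold in_H. intros Hz Hw H. rewrite sep_coord in H.
  apply Rlt_div_l in H; [|nra]. rewrite Rmult_1_l in H.
  pose proof (pow2_ge_0 (Re z - Re w)). pose proof (pow2_ge_0 (Im z - Im w)).
  assert (B1 : Im z / 3 <= Im w) by nra.
  assert (B2 : Im w <= 3 * Im z) by nra.
  split; [split; assumption|]. apply Rabs_le_between. split; nra.
Qed.

Lemma Rabs_le_of_sqr t s : 0 <= s -> t ^ 2 <= s ^ 2 -> Rabs t <= s.
Proof. intros Hs H. apply Rabs_le_between. split; nra. Qed.

(* With [theta = 2 c x + d - a] and [phi = c (x^2 - y^2) + (d - a) x - b], the
   relation [a d - b c = 1] reads
   [y^2 (a + d)^2 + (2 c y^2 + phi)^2 = 4 y^2 + y^2 theta^2 + phi^2]. *)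
Lemma small_displacement_bounded X Y1 Y2 : 0 < Y1 -> exists M, 0 <= M /\ forall A w,
  mat_det A = 1 -> Rabs (Re w) <= X -> Y1 <= Im w <= Y2 -> sep w (mobius A w) < 1 ->
  mat_norm A <= M.
Proof.
  intros HY1.
  set (Cc := 2 / Y1). set (Cad := 2 * Cc * Rabs X + 1).
  set (Cb := Cc * (X ^ 2 + Y2 ^ 2) + Rabs X + Rabs Y2).
  exists (2 * (3 + Cad) + Cc + Cb).
  assert (HCc : 0 < Cc) by (apply Rdiv_lt_0_compat; lra).
  pose proof (Rabs_pos X). pose proof (Rabs_pos Y2).
  assert (0 <= Cad) by (unfold Cad; nra).
  assert (0 <= Cb).
  { unfold Cb. pose proof (pow2_ge_0 X). pose proof (pow2_ge_0 Y2). nra. }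
  split; [lra|]. intros A w HA Hx Hy H3.
  assert (Hw : in_H w) by (unfold in_H; lra).
  rewrite sep_displacement_coord in H3 by assumption.
  unfold mat_det in HA.
  destruct A as [a b c d]; destruct w as [x y]; simpl Re in *; simpl Im in *; simpl in HA.
  cbn [m11 m12 m21 m22] in *.
  assert (0 < y) by lra.
  apply Rlt_div_l in H3; [|nra]. rewrite Rmult_1_l in H3.
  set (th := 2 * c * x + d - a) in *.
  set (ph := c * (x ^ 2 - y ^ 2) + (d - a) * x - b) in *.
  assert (Hid : y ^ 2 * (a + d) ^ 2 + (2 * c * y ^ 2 + ph) ^ 2
      = 4 * y ^ 2 * (a * d - b * c) + y ^ 2 * th ^ 2 + ph ^ 2) by (unfold th, ph; ring).
  rewrite HA in Hid.
  pose proof (pow2_ge_0 ph). pose proof (pow2_ge_0 th).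
  assert (0 < y ^ 2) by nra.
  assert (Hth2 : th ^ 2 <= 1) by (apply Rmult_le_reg_l with (y ^ 2); lra).
  assert (Hyth : 0 <= y ^ 2 * th ^ 2) by (apply Rmult_le_pos; lra).
  assert (Hth : Rabs th <= 1) by (apply Rabs_le_of_sqr; lra).
  assert (Hph : Rabs ph <= y) by (apply Rabs_le_of_sqr; lra).
  pose proof (pow2_ge_0 (2 * c * y ^ 2 + ph)). pose proof (pow2_ge_0 (a + d)).
  (* The right side of the identity is below 5 y^2, which bounds both squares on the left. Then c
     comes from 2 c y^2 + phi, a - d from theta, b from theta and phi, and a, d from their sum and
     difference. *)
  assert (Htr : Rabs (a + d) <= 3).
  { apply Rabs_le_of_sqr; [lra|]. apply Rmult_le_reg_l with (y ^ 2); lra. }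
  assert (0 <= y ^ 2 * (a + d) ^ 2) by (apply Rmult_le_pos; lra).
  assert (Hcy : Rabs (2 * c * y ^ 2 + ph) <= 3 * y) by (apply Rabs_le_of_sqr; lra).
  assert (Hc : Rabs c <= Cc).
  { apply Rabs_le_between in Hcy, Hph.
    assert (Hc2 : - 2 <= c * y <= 2) by (split; nra).
    assert (Rabs (c * y) <= 2) by (apply Rabs_le_between; lra).
    rewrite Rabs_mult, (Rabs_pos_eq y) in * by lra.
    unfold Cc. apply Rle_div_r; [lra|]. pose proof (Rabs_pos c). nra. }
  assert (HxX : Rabs x <= Rabs X) by (pose proof (Rle_abs X); lra).
  assert (Had : Rabs (a - d) <= Cad).
  { replace (a - d) with (2 * c * x - th) by (unfold th; ring). unfold Rminus.
    eapply Rle_trans; [apply Rabs_triang|]. rewrite Rabs_Ropp, !Rabs_mult, (Rabs_pos_eq 2) by lra.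
    unfold Cad. pose proof (Rabs_pos c). pose proof (Rabs_pos x). nra. }
  assert (Hb : Rabs b <= Cb).
  { replace b with (- (c * (x ^ 2 + y ^ 2)) + (th * x + - ph)) by (unfold th, ph; ring).
    eapply Rle_trans; [apply Rabs_triang|].
    pose proof (Rabs_triang (th * x) (- ph)) as Ht.
    rewrite !Rabs_Ropp, !Rabs_mult in *.
    assert (x ^ 2 <= X ^ 2) by (apply pow_maj_Rabs; lra).
    assert (y ^ 2 <= Y2 ^ 2) by (apply pow_maj_Rabs; rewrite ?Rabs_pos_eq; lra).
    pose proof (pow2_ge_0 x).
    rewrite (Rabs_pos_eq (x ^ 2 + y ^ 2)) in * by lra.
    assert (Rabs c * (x ^ 2 + y ^ 2) <= Cc * (X ^ 2 + Y2 ^ 2)).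
    { apply Rmult_le_compat; try lra. apply Rabs_pos. }
    assert (Rabs th * Rabs x <= 1 * Rabs X).
    { apply Rmult_le_compat; try lra; apply Rabs_pos. }
    pose proof (Rle_abs Y2). unfold Cb. lra. }
  assert (Ha : Rabs a <= 3 + Cad).
  { apply Rabs_le_between in Htr, Had. apply Rabs_le_between. lra. }
  assert (Hd : Rabs d <= 3 + Cad).
  { apply Rabs_le_between in Htr, Had. apply Rabs_le_between. lra. }
  unfold mat_norm; cbn [m11 m12 m21 m22]. lra.
Qed.

Lemma Forall_uniform_radius {X : Type} (P : X -> R -> Prop) l :
  (forall x r r', P x r -> r' <= r -> P x r') ->
  (forall x, In x l -> exists r, 0 < r /\ P x r) ->
  exists r, 0 < r /\ forall x, In x l -> P x r.
Proof.
  intros Hmono. induction l as [|a l IH]; intros H.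
  - exists 1; split; [lra|intros x []].
  - destruct IH as (r & Hr & Hl); [intros; apply H; now right|].
    destruct (H a (or_introl eq_refl)) as (r' & Hr' & Ha).
    exists (Rmin r r'); split; [now apply Rmin_pos|].
    intros x [<-|Hx]; eapply Hmono; eauto using Rmin_l, Rmin_r.
Qed.

(** Continuity of the polynomial of [sep_displacement]: it is nonzero at z, and Q z - Q w factors
    through z - w. *)
Lemma displacement_lower_bound_near A z : mat_det A = 1 -> in_H z -> mobius A z <> z ->
  exists r, 0 < r /\ forall w, in_H w -> sep z w < r -> r <= sep w (mobius A w).
Proof.
  intros HA Hz Hne.
  set (Q := fun w : C => (m21 A * w * w + (m22 A - m11 A) * w - m12 A)%C).
  assert (HQ : 0 < Cmod (Q z)).
  { apply Cmod_gt_0. intros E. apply Hne.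
    pose proof (sep_displacement A z HA Hz) as S. fold (Q z) in S. rewrite E, Cmod_0 in S.
    rewrite sep_coord in S. unfold in_H in Hz.
    assert (0 < Im (mobius A z)) by now apply mobius_in_H.
    assert (Hs : (Re z - Re (mobius A z)) ^ 2 + (Im z - Im (mobius A z)) ^ 2 = 0).
    { apply (f_equal (fun t => t * (Im z * Im (mobius A z)))) in S.
      unfold Rdiv in S. rewrite Rmult_assoc, Rinv_l, Rmult_1_r in S by nra. rewrite S. ring. }
    pose proof (pow2_ge_0 (Re z - Re (mobius A z))).
    pose proof (pow2_ge_0 (Im z - Im (mobius A z))).
    apply C_ext; nra. }
  set (y0 := Im z). assert (Hy0 : 0 < y0) by exact Hz.
  set (K := Cmod (RtoC (m21 A)) * (2 * Cmod z + 2 * y0) + Cmod (m22 A - m11 A)%C).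
  assert (HK : 0 <= K).
  { unfold K. pose proof (Cmod_ge_0 (m21 A)). pose proof (Cmod_ge_0 z).
    pose proof (Cmod_ge_0 (m22 A - m11 A)%C). nra. }
  (* If both w and its displacement were within e^2, then |Q w| <= 3 y0 e and |z - w| K <= 2 y0 e K;
     this e makes their sum smaller than |Q z|. *)
  set (e := Rmin 1 (Cmod (Q z) / (3 * y0 + 2 * y0 * K + 1))).
  assert (He : 0 < e).
  { apply Rmin_pos; [lra|]. apply Rdiv_lt_0_compat; [assumption|nra]. }
  assert (He1 : e <= 1) by apply Rmin_l.
  assert (He2 : e * (3 * y0 + 2 * y0 * K + 1) <= Cmod (Q z)).
  { apply Rle_div_r; [nra|apply Rmin_r]. }
  exists (e ^ 2); split; [nra|]. intros w Hw Hs.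
  apply Rnot_lt_le; intros L.
  destruct (sep_lt_1_bounds z w Hz Hw) as [[B1 B2] _]; [nra|].
  assert (D1 : Cmod (z - w)%C <= 2 * y0 * e).
  { eapply Rle_trans; [apply Rle_abs|]. apply Rabs_le_of_sqr; [nra|]. apply Rlt_le.
    unfold sep in Hs. unfold in_H in Hz, Hw. apply (Rlt_div_l _ _ (Im z * Im w)) in Hs; [|nra].
    eapply Rlt_le_trans; [exact Hs|]. unfold y0. nra. }
  assert (D2 : Cmod (Q w) <= 3 * y0 * e).
  { eapply Rle_trans; [apply Rle_abs|]. apply Rabs_le_of_sqr; [nra|]. apply Rlt_le.
    rewrite sep_displacement in L by assumption. fold (Q w) in L.
    unfold in_H in Hw. apply (Rlt_div_l _ _ (Im w ^ 2)) in L; [|nra].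
    eapply Rlt_le_trans; [exact L|]. unfold y0.
    rewrite Rpow_mult_distr, Rmult_comm. apply Rmult_le_compat_r; [nra|].
    apply pow_incr; lra. }
  assert (D3 : Cmod (Q z) <= Cmod (Q w) + Cmod (z - w)%C * K).
  { replace (Q z) with (Q w + (z - w) * (m21 A * (z + w) + (m22 A - m11 A)))%C
      by (unfold Q; ring).
    eapply Rle_trans; [apply Cmod_triangle|]. apply Rplus_le_compat_l.
    rewrite Cmod_mult. apply Rmult_le_compat_l; [apply Cmod_ge_0|].
    eapply Rle_trans; [apply Cmod_triangle|]. apply Rplus_le_compat_r.
    rewrite Cmod_mult. apply Rmult_le_compat_l; [apply Cmod_ge_0|].
    replace (z + w)%C with ((z + z) + - (z - w))%C by ring.
    eapply Rle_trans; [apply Cmod_triangle|]. rewrite Cmod_opp.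
    pose proof (Cmod_triangle z z). nra. }
  assert (Cmod (z - w)%C * K <= 2 * y0 * e * K) by (now apply Rmult_le_compat_r).
  nra.
Qed.

Section CocompactFacts.
Context (G : mat2 -> Prop) (HG : subgroup_PSL G) (HD : discrete G)
  (HF : acts_freely G) (HC : compact_quotient G).

(** Near z only finitely many elements have displacement below 1, and each nontrivial one among them
    fixes no point; the least of finitely many positive radii works. *)
Lemma injectivity_radius_near z : in_H z ->
  exists r, 0 < r /\ forall A w, G A -> ~ eq_PSL A mat_one -> in_H w -> sep z w < r ->
    r <= sep w (mobius A w).
Proof.
  intros Hz. unfold in_H in Hz.
  destruct (small_displacement_bounded (Rabs (Re z) + 2 * Im z) (Im z / 3) (3 * Im z))
    as (M & HM & HMb); [lra|].
  destruct (discrete_bounded_finite G HG M HD HM) as [l Hl].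
  destruct (Forall_uniform_radius (fun A r => G A -> ~ eq_PSL A mat_one ->
    forall w, in_H w -> sep z w < r -> r <= sep w (mobius A w)) l) as (r & Hr & Hrl).
  - intros A r r' H Hle HA HA1 w Hw Hs. specialize (H HA HA1 w Hw). lra.
  - intros A _. destruct (classic (G A /\ ~ eq_PSL A mat_one)) as [[HA HA1]|Hno].
    + destruct (displacement_lower_bound_near A z (G_det G HG A HA) Hz) as (r & Hr & Hw).
      { intros E. apply HA1. now apply HF with z. }
      exists r; split; [exact Hr|]. intros _ _. exact Hw.
    + exists 1; split; [lra|]. intros; tauto.
  - exists (Rmin r 1); split; [apply Rmin_pos; lra|].
    intros A w HA HA1 Hw Hs. pose proof (Rmin_l r 1). pose proof (Rmin_r r 1).
    destruct (Rlt_le_dec (sep w (mobius A w)) 1) as [L|L]; [|lra].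
    destruct (sep_lt_1_bounds z w Hz Hw) as [B1 B2]; [lra|].
    apply Rle_trans with r; [assumption|]. apply Hrl; auto; [|lra].
    apply Hl; [exact HA|]. apply HMb with w; [now apply (G_det G HG)| |assumption..].
    replace (Re w) with (Re z + (Re w - Re z)) by ring.
    eapply Rle_trans; [apply Rabs_triang|]. lra.
Qed.

(** Otherwise points with displacement tending to 0 would accumulate, modulo [G], at some z, against
    the local bound there. *)
Lemma injectivity_radius :
  exists rho, 0 < rho /\ forall A z, G A -> in_H z -> sep z (mobius A z) < rho -> eq_PSL A mat_one.
Proof.
  apply NNPP; intros Hno.
  assert (H : forall n : nat, exists z : C, in_H z /\ exists A, G A /\
    sep z (mobius A z) < / (INR n + 1) /\ ~ eq_PSL A mat_one).
  { intros n. apply NNPP; intros Hn. apply Hno. exists (/ (INR n + 1)). split.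
    - apply Rinv_0_lt_compat. pose proof (pos_INR n). lra.
    - intros A z HA Hz Hs. apply NNPP; intros HA1. apply Hn.
      exists z; split; [exact Hz|]. now exists A. }
  apply functional_choice in H as [u Hu].
  destruct (compact_subsequence G HG u HC (fun n => proj1 (Hu n))) as (z & Hz & Hlim).
  destruct (injectivity_radius_near z Hz) as (r & Hr & Hnear).
  destruct (archimed_cor1 r Hr) as (N & HN & HN0).
  destruct (Hlim r Hr N) as (n & B & HnN & HB & HsB).
  destruct (Hu n) as (Hun & A & HA & HsA & HA1).
  pose proof (G_det G HG B HB) as DB. pose proof (G_det G HG A HA) as DA.
  pose proof (mat_det_inv B) as DBi. rewrite DB in DBi.
  set (w := mobius (mat_inv B) (u n)).
  assert (Hw : in_H w) by now apply mobius_in_H.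
  assert (HBw : mobius B w = u n) by now apply mobius_inv_r.
  (* The point u n is close to B z rather than to z; conjugation by B transports the small
     displacement next to z. *)
  set (A' := mat_mul (mat_inv B) (mat_mul A B)).
  assert (HA' : G A') by (now apply (G_mul G HG); [apply (G_inv G HG)|apply (G_mul G HG)]).
  assert (Hs' : sep w (mobius A' w) = sep (u n) (mobius A (u n))).
  { unfold A'. rewrite !mobius_mul; rewrite ?mat_det_mul, ?DA, ?DB; auto; try lra.
    rewrite HBw. unfold w. rewrite sep_mobius; auto using mobius_in_H. }
  assert (HA1' : ~ eq_PSL A' mat_one).
  { intros HE. apply HA1.
    assert (E : A = mat_mul B (mat_mul A' (mat_inv B))).
    { unfold A'. rewrite <- !mat_mul_assoc, mat_inv_r, mat_mul_1_r by assumption.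
      now rewrite mat_mul_inv_l. }
    destruct HE as [HE|HE]; [left|right]; rewrite E, HE.
    - now rewrite mat_mul_1_l, mat_inv_r.
    - transitivity (mat_opp (mat_mul B (mat_inv B))); [mat_solve|now rewrite mat_inv_r]. }
  assert (sep z w < r).
  { rewrite <- (sep_mobius B z w DB Hz Hw), HBw, sep_sym. exact HsB. }
  specialize (Hnear A' w HA' HA1' Hw H). rewrite Hs' in Hnear.
  assert (/ (INR n + 1) < / INR N); [|lra].
  apply Rinv_lt_contravar; [|].
  - apply Rmult_lt_0_compat; [now apply lt_0_INR|]. pose proof (pos_INR n); lra.
  - apply le_INR in HnN. lra.
Qed.

Definition in_box (B : R) (z : C) : Prop := Rabs (Re z) <= B /\ / B <= Im z <= B.

(** Orbits avoiding larger and larger boxes would have a subsequence converging in the quotient to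
    some z, while a neighbourhood of z lies in a single box. *)
Lemma cocompact_box : exists B, 1 <= B /\ forall z, in_H z -> exists A, G A /\ in_box B (mobius A z).
Proof.
  apply NNPP; intros Hno.
  assert (H : forall n : nat, exists z : C, in_H z /\ forall A, G A -> ~ in_box (INR n + 1) (mobius A z)).
  { intros n. apply NNPP; intros Hn. apply Hno. exists (INR n + 1). split.
    - pose proof (pos_INR n). lra.
    - intros z Hz. apply NNPP; intros HA. apply Hn. exists z; split; [exact Hz|].
      intros A HGA Hb. apply HA. now exists A. }
  apply functional_choice in H as [u Hu].
  destruct (compact_subsequence G HG u HC (fun n => proj1 (Hu n))) as (z & Hz & Hlim).
  destruct (INR_unbounded (Rabs (Re z) + 3 * Im z + 3 / Im z)) as [N HN].
  destruct (Hlim 1 Rlt_0_1 N) as (n & A & HnN & HA & Hs).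
  destruct (Hu n) as (Hun & HnA).
  pose proof (G_det G HG A HA) as DA.
  pose proof (mat_det_inv A) as DAi. rewrite DA in DAi.
  apply (HnA (mat_inv A)); [now apply (G_inv G HG)|].
  set (w := mobius (mat_inv A) (u n)).
  assert (Hw : in_H w) by now apply mobius_in_H.
  assert (HAw : mobius A w = u n) by now apply mobius_inv_r.
  rewrite <- HAw, sep_mobius, sep_sym in Hs by assumption.
  destruct (sep_lt_1_bounds z w Hz Hw Hs) as [[B1 B2] B3].
  unfold in_H in *. apply le_INR in HnN. pose proof (Rabs_pos (Re z)).
  assert (0 < 3 / Im z) by (apply Rdiv_lt_0_compat; lra).
  split; [|split].
  - replace (Re w) with (Re z + (Re w - Re z)) by ring.
    eapply Rle_trans; [apply Rabs_triang|]. lra.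
  - apply Rle_trans with (Im z / 3); [|assumption].
    replace (Im z / 3) with (/ (3 / Im z)) by (field; lra).
    apply Rinv_le_contravar; lra.
  - lra.
Qed.

(** Elliptic and parabolic elements have points of arbitrarily small displacement, which the
    injectivity radius forbids. *)
Lemma hyperbolic_of_nontrivial A : G A -> ~ eq_PSL A mat_one -> 2 < Rabs (mat_tr A).
Proof.
  intros HA HA1. apply Rnot_le_lt; intros L. apply HA1.
  destruct injectivity_radius as (rho & Hrho & Hinj).
  pose proof (G_det G HG A HA) as DA.
  assert (Htr : mat_tr A ^ 2 <= 4).
  { apply Rabs_le_between in L. nra. }
  assert (Hz : exists z, in_H z /\ sep z (mobius A z) < rho);
    [|destruct Hz as (z & Hz & Hs); now apply Hinj with z].
  unfold mat_tr, mat_det in *. destruct A as [a b c d]; simpl in *.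
  destruct (Req_dec c 0) as [->|Hc].
  (* For c = 0 the trace bound gives a = d, a horizontal translation whose [sep] at height y is b^2
     / y^2: a high point is taken. *)
  - assert (E : (a - d) ^ 2 = 0) by (pose proof (pow2_ge_0 (a - d)); nra).
    assert (a = d) by nra. subst d.
    set (y := (b ^ 2 + 1) / rho + 1).
    assert (Hy : 1 < y).
    { unfold y. assert (0 < (b ^ 2 + 1) / rho); [|lra].
      apply Rdiv_lt_0_compat; [|lra]. pose proof (pow2_ge_0 b). lra. }
    exists (0, y). assert (Hz : in_H (0, y)) by (unfold in_H; simpl; lra).
    split; [exact Hz|]. rewrite sep_displacement_coord by (unfold mat_det; simpl; auto; lra).
    simpl. apply Rlt_div_l; [nra|].
    assert (b ^ 2 + 1 < rho * y).
    { unfold y. rewrite Rmult_plus_distr_l. unfold Rdiv.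
      rewrite <- Rmult_assoc, (Rmult_comm rho), Rmult_assoc, Rinv_r by lra. lra. }
    nra.
  (* On the vertical line Re z = (a - d) / (2 c) the displacement has the closed form [HE]. If t > 0
     it vanishes at the elliptic fixed point; if t = 0 it tends to 0 towards the parabolic one on
     the real axis. *)
  - set (t := 4 - (a + d) ^ 2). assert (Ht : 0 <= t) by (unfold t; lra).
    assert (HE : forall y, 0 < y -> sep ((a - d) / (2 * c), y) (mobius (Mat2 a b c d) ((a - d) / (2 * c), y))
      = (c * y - t / (4 * c * y)) ^ 2).
    { intros y Hy. rewrite sep_displacement_coord by (unfold in_H, mat_det; simpl; auto; lra).
      unfold t. replace 4 with (4 * (a * d - b * c)) at 1 by (rewrite DA; ring).
      simpl. field. split; lra. }
    pose proof (Rabs_pos_lt c Hc) as Hc'.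
    assert (Hcc : c * c = Rabs c * Rabs c) by (rewrite <- Rabs_mult, Rabs_pos_eq; nra).
    destruct Ht as [Ht|Ht].
    + exists ((a - d) / (2 * c), sqrt t / (2 * Rabs c)).
      assert (0 < sqrt t / (2 * Rabs c)) by (apply Rdiv_lt_0_compat; [now apply sqrt_lt_R0|lra]).
      split; [exact H|]. rewrite HE by assumption.
      replace (c * _ - _) with 0; [simpl; lra|].
      pose proof (sqrt_lt_R0 t Ht).
      assert (Hst : sqrt t * sqrt t = t) by (apply sqrt_sqrt; lra).
      rewrite <- Hst at 2.
      replace (sqrt t * sqrt t / (4 * c * (sqrt t / (2 * Rabs c))))
        with (sqrt t * (Rabs c * Rabs c) / (2 * c * Rabs c)) by (field; repeat split; lra).
      rewrite <- Hcc. field. lra.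
    + exists ((a - d) / (2 * c), Rmin 1 rho / (2 * Rabs c)).
      pose proof (Rmin_pos 1 rho Rlt_0_1 Hrho).
      pose proof (Rmin_l 1 rho). pose proof (Rmin_r 1 rho).
      assert (0 < Rmin 1 rho / (2 * Rabs c)) by (apply Rdiv_lt_0_compat; lra).
      split; [exact H2|]. rewrite HE, <- Ht by assumption.
      replace (_ ^ 2) with ((c * c) * (Rmin 1 rho / (2 * Rabs c)) ^ 2) by (unfold Rdiv; ring).
      rewrite Hcc. replace (_ * _) with (Rmin 1 rho ^ 2 / 4) by (field; lra). nra.
Qed.

End CocompactFacts.

(** * Non-elementarity *)

Definition mat_vec (A : mat2) (v : R * R) : R * R :=
  (m11 A * fst v + m12 A * snd v, m21 A * fst v + m22 A * snd v).

(** A nonzero v is an eigenvector of A exactly when [wedge v (mat_vec A v)] is 0. *)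
Definition wedge (v w : R * R) : R := fst v * snd w - snd v * fst w.

Definition vec_norm (v : R * R) : R := Rabs (fst v) + Rabs (snd v).

Lemma mat_vec_mul A B v : mat_vec (mat_mul A B) v = mat_vec A (mat_vec B v).
Proof. unfold mat_vec; simpl; f_equal; ring. Qed.

Lemma mat_vec_one v : mat_vec mat_one v = v.
Proof. destruct v; unfold mat_vec; simpl; f_equal; ring. Qed.

Lemma vec_norm_pos v : 0 <= vec_norm v.
Proof. unfold vec_norm. pose proof (Rabs_pos (fst v)); pose proof (Rabs_pos (snd v)); lra. Qed.

Lemma vec_norm_mat_vec A v : vec_norm (mat_vec A v) <= mat_norm A * vec_norm v.
Proof.
  unfold vec_norm, mat_norm, mat_vec; destruct v as [x y]; simpl.
  pose proof (Rabs_triang (m11 A * x) (m12 A * y)) as T1.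
  pose proof (Rabs_triang (m21 A * x) (m22 A * y)) as T2.
  rewrite !Rabs_mult in T1, T2.
  pose proof (Rabs_pos (m11 A)); pose proof (Rabs_pos (m12 A));
  pose proof (Rabs_pos (m21 A)); pose proof (Rabs_pos (m22 A)).
  pose proof (Rabs_pos x); pose proof (Rabs_pos y). nra.
Qed.

(** For determinants 1 the right side is 2, the trace that [trace_two_trivial] excludes for
    nontrivial elements. *)
Lemma commutator_upper_triangular_tr (l1 b1 u1 l2 b2 u2 : R) :
  mat_tr (mat_mul (mat_mul (Mat2 l1 b1 0 u1) (Mat2 l2 b2 0 u2))
    (mat_mul (mat_inv (Mat2 l1 b1 0 u1)) (mat_inv (Mat2 l2 b2 0 u2))))
  = 2 * (l1 * u1) * (l2 * u2).
Proof. unfold mat_tr; simpl; ring. Qed.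

(** When l <> u, the ratio b / (l - u) locates the second fixed point; commuting elements share
    it. *)
Lemma commuting_upper_triangular (l1 b1 u1 l2 b2 u2 : R) :
  mat_mul (Mat2 l1 b1 0 u1) (Mat2 l2 b2 0 u2) = mat_mul (Mat2 l2 b2 0 u2) (Mat2 l1 b1 0 u1) ->
  b2 * (l1 - u1) = b1 * (l2 - u2).
Proof. intros E. apply (f_equal m12) in E; simpl in E. lra. Qed.

(** In an affine chart of the projective line, [wedge v (mat_vec A v)] is such a quadratic. One d is
    radius, lower bound and at most e at once, as [uniform_on_interval] has a single parameter. *)
Lemma quadratic_nonzero_near p0 p1 p2 t : -1 <= t <= 1 -> p0 + p1 * t + p2 * t ^ 2 <> 0 ->
  forall e, 0 < e ->
  exists d, 0 < d /\ d <= e /\ forall x, Rabs (x - t) < d -> d <= Rabs (p0 + p1 * x + p2 * x ^ 2).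
Proof.
  intros Ht Hq e He. set (q := p0 + p1 * t + p2 * t ^ 2) in *.
  pose proof (Rabs_pos_lt q Hq) as Hq'.
  set (K := Rabs p1 + 3 * Rabs p2). pose proof (Rabs_pos p1). pose proof (Rabs_pos p2).
  assert (HK : 0 <= K) by (unfold K; lra).
  set (d := Rmin (Rmin 1 e) (Rabs q / (K + 1))).
  assert (Hd : 0 < d).
  { repeat apply Rmin_pos; try lra. apply Rdiv_lt_0_compat; lra. }
  assert (Hd1 : d <= 1) by (eapply Rle_trans; apply Rmin_l).
  assert (Hde : d <= e) by (eapply Rle_trans; [apply Rmin_l|apply Rmin_r]).
  assert (HdK : d * (K + 1) <= Rabs q) by (apply Rle_div_r; [lra|apply Rmin_r]).
  exists d; split; [exact Hd|split; [exact Hde|]]. intros x Hx.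
  replace (p0 + p1 * x + p2 * x ^ 2) with (q - (t - x) * (p1 + p2 * (x + t)))
    by (unfold q; ring).
  pose proof (Rabs_triang_inv q ((t - x) * (p1 + p2 * (x + t)))) as T.
  rewrite Rabs_mult, (Rabs_minus_sym t x) in T.
  assert (Rabs (p1 + p2 * (x + t)) <= K).
  { eapply Rle_trans; [apply Rabs_triang|]. rewrite Rabs_mult. unfold K.
    assert (Rabs (x + t) <= 3); [|nra].
    apply Rabs_lt_between in Hx. apply Rabs_le_between. lra. }
  assert (Rabs (x - t) * Rabs (p1 + p2 * (x + t)) <= d * K).
  { apply Rmult_le_compat; try apply Rabs_pos; lra. }
  lra.
Qed.

Lemma uniform_on_interval (P : R -> R -> Prop) :
  (forall x d d', P x d -> 0 < d' -> d' <= d -> P x d') ->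
  (forall t, -1 <= t <= 1 -> exists d, 0 < d /\ forall x, Rabs (x - t) < d -> P x d) ->
  exists d, 0 < d /\ forall x, -1 <= x <= 1 -> P x d.
Proof.
  intros Hmono Hloc.
  assert (H : forall t, exists d : posreal, -1 <= t <= 1 -> forall x, Rabs (x - t) < d -> P x d).
  { intros t. destruct (classic (-1 <= t <= 1)) as [Ht|Ht].
    (* [compactness_value_1d] takes a gauge defined on all of R, so 1 is the default outside the
       interval; its conclusion is doubly negated, hence [NNPP] below. *)
    - destruct (Hloc t Ht) as (d & Hd & Hx). exists (mkposreal d Hd). now intros _.
    - exists (mkposreal 1 Rlt_0_1). tauto. }
  apply functional_choice in H as [delta Hdelta].
  destruct (compactness_value_1d (-1) 1 delta) as [d Hd].
  exists d; split; [apply cond_pos|]. intros x Hx.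
  destruct (NNPP _ (Hd x Hx)) as (t & Ht & Hxt & Hdt).
  apply Hmono with (delta t); auto using cond_pos.
Qed.

(* If [u] were nearly parallel to both [w1] and [w2], these would be nearly parallel:
   [(w1 ^ w2) u = (u ^ w2) w1 - (u ^ w1) w2]. *)
Lemma wedge_dichotomy u w1 w2 k M n : 0 < k -> 0 < M -> 0 < n -> 0 < vec_norm u ->
  k * n ^ 2 <= Rabs (wedge w1 w2) -> vec_norm w1 <= M * n -> vec_norm w2 <= M * n ->
  Rabs (wedge u w1) < k / (4 * M) * vec_norm u * n ->
  Rabs (wedge u w2) < k / (4 * M) * vec_norm u * n -> False.
Proof.
  intros Hk HM Hn Hu Hw H1 H2 B1 B2.
  set (b := k / (4 * M) * vec_norm u * n) in *.
  assert (C1 : Rabs (wedge w1 w2) * vec_norm u <=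
    Rabs (wedge u w2) * vec_norm w1 + Rabs (wedge u w1) * vec_norm w2).
  { unfold vec_norm. rewrite !Rmult_plus_distr_l, <- !Rabs_mult.
    assert (E1 : wedge w1 w2 * fst u = wedge u w2 * fst w1 + - (wedge u w1 * fst w2))
      by (unfold wedge; ring).
    assert (E2 : wedge w1 w2 * snd u = wedge u w2 * snd w1 + - (wedge u w1 * snd w2))
      by (unfold wedge; ring).
    rewrite E1, E2.
    pose proof (Rabs_triang (wedge u w2 * fst w1) (- (wedge u w1 * fst w2))).
    pose proof (Rabs_triang (wedge u w2 * snd w1) (- (wedge u w1 * snd w2))).
    rewrite !Rabs_Ropp in *. lra. }
  assert (Rabs (wedge u w2) * vec_norm w1 <= b * (M * n)).
  { apply Rmult_le_compat; try apply Rabs_pos; try apply vec_norm_pos; lra. }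
  assert (Rabs (wedge u w1) * vec_norm w2 <= b * (M * n)).
  { apply Rmult_le_compat; try apply Rabs_pos; try apply vec_norm_pos; lra. }
  assert (k * n ^ 2 * vec_norm u <= Rabs (wedge w1 w2) * vec_norm u)
    by (apply Rmult_le_compat_r; lra).
  assert (Hb : b * (M * n) = k * n ^ 2 * vec_norm u / 4) by (unfold b; field; lra).
  assert (0 < k * n ^ 2 * vec_norm u) by (repeat apply Rmult_lt_0_compat; try apply pow_lt; lra).
  lra.
Qed.

Section NonElementary.
Context (G : mat2 -> Prop) (HG : subgroup_PSL G) (HD : discrete G)
  (HF : acts_freely G) (HC : compact_quotient G).

(** A point above the box has to be moved in order to enter it. *)
Lemma exists_nontrivial : exists A, G A /\ ~ eq_PSL A mat_one.
Proof.
  destruct (cocompact_box G HG HC) as (B & HB & Hbox).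
  assert (Hz : in_H (0, B + 1)) by (unfold in_H; simpl; lra).
  destruct (Hbox _ Hz) as (A & HA & _ & Him).
  exists A; split; [exact HA|]. intros [->| ->].
  - rewrite mobius_one in Him. simpl in Him. lra.
  - rewrite mobius_opp, mobius_one in Him; [|unfold mat_det; simpl; lra|exact Hz].
    simpl in Him. lra.
Qed.

Lemma trace_two_trivial A : G A -> mat_tr A = 2 -> A = mat_one.
Proof.
  intros HA Htr. destruct (classic (eq_PSL A mat_one)) as [[E|E]|E].
  - exact E.
  - rewrite E in Htr. unfold mat_tr in Htr; simpl in Htr. lra.
  - apply (hyperbolic_of_nontrivial G HG HD HF HC A HA) in E. rewrite Htr, Rabs_pos_eq in E; lra.
Qed.

(* Elements with a common eigenvector are simultaneously upper triangular, so commutators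
   have trace 2, hence are trivial; the group is then diagonalizable and
   preserves the distance to an axis, which contradicts cocompactness. *)
Lemma no_common_eigenvector v : v <> (0, 0) -> exists A, G A /\ wedge v (mat_vec A v) <> 0.
Proof.
  intros Hv. apply NNPP; intros Hno.
  assert (Hall : forall A, G A -> wedge v (mat_vec A v) = 0).
  { intros A HA. apply NNPP; intros H. apply Hno. now exists A. }
  clear Hno. destruct v as [x y].
  assert (Hn : 0 < x ^ 2 + y ^ 2).
  { pose proof (pow2_ge_0 x). pose proof (pow2_ge_0 y).
    destruct (Req_dec x 0) as [->|Hx]; [|pose proof (pow2_gt_0 x Hx); lra].
    destruct (Req_dec y 0) as [->|Hy]; [now destruct Hv|pose proof (pow2_gt_0 y Hy); lra]. }
  (* A determinant 1 matrix with first column v: conjugation by it makes all of [G] upper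
     triangular. *)
  set (N := Mat2 x (- y / (x ^ 2 + y ^ 2)) y (x / (x ^ 2 + y ^ 2))).
  assert (DN : mat_det N = 1) by (unfold mat_det; simpl; field; lra).
  assert (DNi : mat_det (mat_inv N) = 1) by now rewrite mat_det_inv.
  set (cj := fun A => mat_mul (mat_inv N) (mat_mul A N)).
  assert (cj_mul : forall A B, cj (mat_mul A B) = mat_mul (cj A) (cj B)).
  { intros A B. unfold cj. rewrite <- !mat_mul_assoc. now rewrite mat_mul_inv_l. }
  assert (cj_inv : forall A, cj (mat_inv A) = mat_inv (cj A)).
  { intros A. unfold cj. rewrite !mat_inv_mul, mat_inv_inv. now rewrite mat_mul_assoc. }
  assert (cj_tr : forall A, mat_tr (cj A) = mat_tr A).
  { intros A. replace (mat_tr A) with (mat_tr A * mat_det N) by (rewrite DN; ring).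
    unfold mat_tr, cj, mat_det; simpl. ring. }
  assert (cj_det : forall A, G A -> mat_det (cj A) = 1).
  { intros A HA. unfold cj. rewrite !mat_det_mul, DN, DNi, (G_det G HG A HA). ring. }
  assert (cj_tri : forall A, G A -> cj A = Mat2 (m11 (cj A)) (m12 (cj A)) 0 (m22 (cj A))).
  { intros A HA. apply mat_ext; try reflexivity. rewrite <- (Hall A HA).
    unfold wedge, mat_vec; simpl. ring. }
  assert (cj_diag : forall A, G A -> m11 (cj A) * m22 (cj A) = 1).
  { intros A HA. pose proof (cj_det A HA) as D. rewrite (cj_tri A HA) in D.
    unfold mat_det in D; simpl in D. simpl. lra. }
  destruct exists_nontrivial as (A0 & HA0 & HA0n).
  pose proof (hyperbolic_of_nontrivial G HG HD HF HC A0 HA0 HA0n) as Htr0.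
  rewrite <- cj_tr in Htr0.
  assert (Hne : m11 (cj A0) - m22 (cj A0) <> 0).
  { intros E. unfold mat_tr in Htr0. pose proof (cj_diag A0 HA0).
    assert (E' : m22 (cj A0) = m11 (cj A0)) by lra. rewrite E' in *.
    destruct (Rcase_abs (m11 (cj A0) + m11 (cj A0))) as [L|L];
      [rewrite Rabs_left in Htr0|rewrite Rabs_right in Htr0]; nra. }
  (* The second fixed point of [cj A0] is -s. Once it is shared, each conjugate acts as w + s -> l^2
     (w + s) and preserves (Re w + s) / Im w. *)
  set (s := m12 (cj A0) / (m11 (cj A0) - m22 (cj A0))).
  assert (Hshear : forall B, G B -> m12 (cj B) = s * (m11 (cj B) - m22 (cj B))).
  { intros B HB.
    set (K := mat_mul (mat_mul A0 B) (mat_mul (mat_inv A0) (mat_inv B))).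
    assert (HK : G K).
    { unfold K. apply (G_mul G HG); apply (G_mul G HG); try apply (G_inv G HG); assumption. }
    assert (HKtr : mat_tr K = 2).
    { rewrite <- cj_tr. unfold K. rewrite !cj_mul, !cj_inv.
      rewrite (cj_tri A0 HA0), (cj_tri B HB), commutator_upper_triangular_tr.
      rewrite (cj_diag A0 HA0), (cj_diag B HB). ring. }
    apply trace_two_trivial in HKtr; [|exact HK].
    assert (Hcomm : mat_mul A0 B = mat_mul B A0).
    { assert (E : mat_mul K (mat_mul B A0) = mat_mul A0 B).
      { unfold K. rewrite <- !mat_mul_assoc. rewrite mat_inv_mul_l by now apply (G_det G HG).
        rewrite mat_inv_l by now apply (G_det G HG). now rewrite mat_mul_1_r. }
      rewrite <- E, HKtr. now rewrite mat_mul_1_l. }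
    apply (f_equal cj) in Hcomm. rewrite !cj_mul in Hcomm.
    rewrite (cj_tri A0 HA0), (cj_tri B HB) in Hcomm.
    apply commuting_upper_triangular in Hcomm.
    unfold s. apply Rmult_eq_reg_r with (m11 (cj A0) - m22 (cj A0)); [|assumption].
    rewrite Hcomm. field. assumption. }
  destruct (cocompact_box G HG HC) as (B & HB & Hbox).
  set (n := mat_norm (mat_inv N)).
  (* A point at height 1 too far from the axis Re w = -s: over the box, (X + s) Im p will be bounded
     by the factor of B here, while Im p >= 1 / B. *)
  set (X := - s + (B * (2 * (n * B) ^ 2 * (1 + Rabs s)) + 1)).
  set (w := (X, 1) : C).
  assert (Hw : in_H w) by (unfold in_H; simpl; lra).
  destruct (Hbox (mobius N w) (mobius_in_H N w DN Hw)) as (A & HA & Hp).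
  set (p := mobius A (mobius N w)) in *.
  pose proof (G_det G HG A HA) as DA.
  assert (Hpin : in_H p) by (unfold p; auto using mobius_in_H).
  assert (Hpw : mobius (mat_inv N) p = mobius (cj A) w).
  { unfold p, cj. rewrite !mobius_mul; rewrite ?mat_det_mul, ?DA, ?DN; auto; lra. }
  clearbody p.
  pose proof (f_equal Re Hpw) as ER. pose proof (f_equal Im Hpw) as EI.
  rewrite mobius_Re in ER by assumption. rewrite mobius_Im in EI by assumption.
  rewrite mobius_Re in ER by auto. rewrite mobius_Im in EI by auto.
  unfold auto_factor in ER at 2. unfold auto_factor in EI at 2.
  rewrite (cj_tri A HA), (Hshear A HA) in ER. rewrite (cj_tri A HA) in EI.
  cbn [m11 m12 m21 m22] in ER, EI. simpl Re in ER. simpl Im in ER, EI.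
  pose proof (cj_diag A HA) as Hd.
  set (l := m11 (cj A)) in *. set (u := m22 (cj A)) in *.
  assert (Hl : l <> 0) by (intros E; rewrite E in Hd; lra).
  assert (Hu : u = / l) by (apply Rmult_eq_reg_l with l; [rewrite Hd; field|]; assumption).
  rewrite Hu in ER, EI.
  pose proof (auto_factor_pos (mat_inv N) p DNi Hpin) as Hq.
  set (q := auto_factor (mat_inv N) p) in *.
  set (num := (m11 (mat_inv N) * Re p + m12 (mat_inv N)) *
     (m21 (mat_inv N) * Re p + m22 (mat_inv N)) +
     m11 (mat_inv N) * m21 (mat_inv N) * Im p ^ 2) in *.
  (* Invariance of (Re + s) / Im between w and N^-1 p, cleared of denominators. *)
  assert (HX : (X + s) * Im p = num + s * q).
  { assert (E1 : num = q * (l ^ 2 * (X + s) - s)).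
    { apply Rmult_eq_reg_r with (/ q); [|apply Rinv_neq_0_compat; lra].
      unfold Rdiv at 1 in ER. rewrite ER. field. split; [lra|assumption]. }
    assert (E2 : Im p = q * l ^ 2).
    { apply Rmult_eq_reg_r with (/ q); [|apply Rinv_neq_0_compat; lra].
      unfold Rdiv at 1 in EI. rewrite EI. field. split; [lra|assumption]. }
    rewrite E1, E2. ring. }
  destruct Hp as [Hp1 [Hp2 Hp3]].
  assert (Hip : Rabs (Im p) <= B) by (unfold in_H in Hpin; rewrite Rabs_pos_eq; lra).
  assert (Hn0 : 0 <= n) by apply mat_norm_pos.
  assert (T : forall a b, Rabs a + Rabs b <= n -> Rabs (a * Re p + b) <= n * B).
  { intros a b Hab. eapply Rle_trans; [apply Rabs_triang|]. rewrite Rabs_mult.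
    pose proof (Rabs_pos a). pose proof (Rabs_pos b). pose proof (Rabs_pos (Re p)). nra. }
  assert (T' : forall a, Rabs a <= n -> Rabs (a * Im p) <= n * B).
  { intros a Ha. rewrite Rabs_mult. apply Rmult_le_compat; try apply Rabs_pos; assumption. }
  assert (T2 : forall a b, Rabs a <= n * B -> Rabs b <= n * B -> Rabs (a * b) <= (n * B) ^ 2).
  { intros a b Ha Hb. rewrite Rabs_mult. simpl. rewrite Rmult_1_r.
    apply Rmult_le_compat; try apply Rabs_pos; assumption. }
  destruct (mat_norm_entries (mat_inv N)) as (N1 & N2 & N3 & N4). fold n in N1, N2, N3, N4.
  assert (Hr1 : Rabs (m11 (mat_inv N)) + Rabs (m12 (mat_inv N)) <= n).
  { unfold n, mat_norm. pose proof (Rabs_pos (m21 (mat_inv N))).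
    pose proof (Rabs_pos (m22 (mat_inv N))). lra. }
  assert (Hr2 : Rabs (m21 (mat_inv N)) + Rabs (m22 (mat_inv N)) <= n).
  { unfold n, mat_norm. pose proof (Rabs_pos (m11 (mat_inv N))).
    pose proof (Rabs_pos (m12 (mat_inv N))). lra. }
  assert (Hnum : Rabs num <= 2 * (n * B) ^ 2).
  { unfold num. eapply Rle_trans; [apply Rabs_triang|].
    pose proof (T2 _ _ (T _ _ Hr1) (T _ _ Hr2)).
    pose proof (T2 _ _ (T' _ N1) (T' _ N3)) as T3.
    replace (m11 (mat_inv N) * Im p * (m21 (mat_inv N) * Im p))
      with (m11 (mat_inv N) * m21 (mat_inv N) * Im p ^ 2) in T3 by ring. lra. }
  assert (Hqb : Rabs q <= 2 * (n * B) ^ 2).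
  { unfold q, auto_factor. eapply Rle_trans; [apply Rabs_triang|].
    pose proof (T2 _ _ (T _ _ Hr2) (T _ _ Hr2)). pose proof (T2 _ _ (T' _ N3) (T' _ N3)).
    simpl. rewrite !Rmult_1_r. simpl in H, H0. rewrite !Rmult_1_r in H, H0. lra. }
  assert (Hfin : (X + s) * Im p <= 2 * (n * B) ^ 2 * (1 + Rabs s)).
  { rewrite HX. eapply Rle_trans; [apply Rle_abs|].
    eapply Rle_trans; [apply Rabs_triang|]. rewrite Rabs_mult.
    pose proof (Rabs_pos s). nra. }
  set (W := 2 * (n * B) ^ 2 * (1 + Rabs s)) in *.
  assert (HW : 0 <= W).
  { unfold W. pose proof (Rabs_pos s). pose proof (pow2_ge_0 (n * B)). nra. }
  assert (HXs : X + s = B * W + 1) by (unfold X; lra).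
  rewrite HXs in Hfin.
  assert (1 <= B * Im p).
  { apply (Rmult_le_compat_l B) in Hp2; [|lra]. rewrite Rinv_r in Hp2; lra. }
  unfold in_H in Hpin. nra.
Qed.

(** Compactness of the projective line, covered by the charts (1, t) and (t, 1) with |t| <= 1; both
    sides are homogeneous of degree 2 in v. *)
Lemma uniform_non_eigenvector : exists k, 0 < k /\ forall v, exists A,
  G A /\ mat_norm A <= / k /\ k * vec_norm v ^ 2 <= Rabs (wedge v (mat_vec A v)).
Proof.
  set (P := fun (chart : R -> R * R) (x d : R) => exists A, G A /\ mat_norm A <= / d /\
    d <= Rabs (wedge (chart x) (mat_vec A (chart x)))).
  assert (Hunif : forall chart,
    (forall t, chart t <> (0, 0)) ->
    (forall A, exists p0 p1 p2, forall x, wedge (chart x) (mat_vec A (chart x)) = p0 + p1 * x + p2 * x ^ 2) ->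
    exists d, 0 < d /\ forall x, -1 <= x <= 1 -> P chart x d).
  { intros chart Hne Hpol. apply uniform_on_interval.
    - intros x d d' (A & HA & HAn & HAd) Hd' Hle. exists A. split; [exact HA|split; [|lra]].
      eapply Rle_trans; [exact HAn|]. now apply Rinv_le_contravar.
    - intros t Ht. destruct (no_common_eigenvector (chart t) (Hne t)) as (A & HA & HAw).
      destruct (Hpol A) as (p0 & p1 & p2 & Hp). rewrite Hp in HAw.
      pose proof (mat_norm_pos A).
      destruct (quadratic_nonzero_near p0 p1 p2 t Ht HAw (/ (mat_norm A + 1)))
        as (d & Hd & Hde & Hx); [apply Rinv_0_lt_compat; lra|].
      exists d; split; [exact Hd|]. intros x Hxt. exists A.
      rewrite Hp. split; [exact HA|split; [|now apply Hx]].
      apply Rinv_le_contravar in Hde; [|exact Hd]. rewrite Rinv_inv in Hde. lra. }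
  destruct (Hunif (fun t => (1, t))) as (d1 & Hd1 & H1).
  { intros t E. injection E; lra. }
  { intros A. exists (m21 A), (m22 A - m11 A), (- m12 A). intros x.
    unfold wedge, mat_vec; simpl; ring. }
  destruct (Hunif (fun t => (t, 1))) as (d2 & Hd2 & H2).
  { intros t E. injection E; lra. }
  { intros A. exists (- m12 A), (m22 A - m11 A), (m21 A). intros x.
    unfold wedge, mat_vec; simpl; ring. }
  (* The 4 bounds (1 + |t|)^2, the squared [vec_norm] of the chart vector. *)
  set (k := Rmin d1 d2 / 4).
  assert (Hmin : 0 < Rmin d1 d2) by now apply Rmin_pos.
  pose proof (Rmin_l d1 d2). pose proof (Rmin_r d1 d2).
  exists k; split; [unfold k; lra|].
  assert (Hscale : forall a t d (v v0 : R * R) A, Rabs t <= 1 -> vec_norm v = Rabs a * (1 + Rabs t) ->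
    wedge v (mat_vec A v) = a ^ 2 * wedge v0 (mat_vec A v0) -> Rmin d1 d2 <= d ->
    d <= Rabs (wedge v0 (mat_vec A v0)) -> k * vec_norm v ^ 2 <= Rabs (wedge v (mat_vec A v))).
  { intros a t d v v0 A Ht Hv Hw Hdm Hd. rewrite Hw, Hv, Rabs_mult, <- RPow_abs, Rpow_mult_distr.
    unfold k. pose proof (Rabs_pos t). pose proof (pow2_ge_0 (Rabs a)).
    assert ((1 + Rabs t) ^ 2 <= 4) by nra.
    assert (Rmin d1 d2 / 4 * (1 + Rabs t) ^ 2 <= Rabs (wedge v0 (mat_vec A v0))) by nra.
    nra. }
  assert (Hinv : forall d, Rmin d1 d2 <= d -> / d <= / k).
  { intros d Hd. apply Rinv_le_contravar; unfold k; lra. }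
  assert (Hratio : forall a b, Rabs b <= Rabs a -> exists t, Rabs t <= 1 /\ b = a * t).
  { intros a b Hab. destruct (Req_dec a 0) as [->|Ha].
    - exists 0. rewrite Rabs_R0 in *. split; [lra|].
      destruct (Req_dec b 0) as [->|Hb]; [ring|pose proof (Rabs_pos_lt b Hb); lra].
    - exists (b / a). split; [|field; assumption]. unfold Rdiv. rewrite Rabs_mult, Rabs_inv.
      apply Rle_div_l; [now apply Rabs_pos_lt|]. lra. }
  intros [x y]. destruct (Rle_lt_dec (Rabs y) (Rabs x)) as [L|L].
  - destruct (Hratio x y L) as (t & Ht & ->).
    destruct (H1 t) as (A & HA & HAn & HAw); [now apply Rabs_le_between|].
    exists A; split; [exact HA|split].
    + eapply Rle_trans; [exact HAn|now apply Hinv].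
    + apply Hscale with x t d1 (1, t); try assumption.
      * unfold vec_norm; simpl. rewrite Rabs_mult. ring.
      * unfold wedge, mat_vec; simpl. ring.
  - destruct (Hratio y x) as (t & Ht & ->); [lra|].
    destruct (H2 t) as (A & HA & HAn & HAw); [now apply Rabs_le_between|].
    exists A; split; [exact HA|split].
    + eapply Rle_trans; [exact HAn|now apply Hinv].
    + apply Hscale with y t d2 (t, 1); try assumption.
      * unfold vec_norm; simpl. rewrite Rabs_mult. ring.
      * unfold wedge, mat_vec; simpl. ring.
Qed.

(* Among [v], [A v], [A^2 v], pairwise far from parallel, each [u_i] is nearly parallel
   to at most one. *)
Lemma uniform_separation : exists c M, 0 < c /\ 1 <= M /\ forall v u1 u2, exists A,
  G A /\ mat_norm A <= M /\
  c * vec_norm u1 * vec_norm v <= Rabs (wedge u1 (mat_vec A v)) /\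
  c * vec_norm u2 * vec_norm v <= Rabs (wedge u2 (mat_vec A v)).
Proof.
  destruct uniform_non_eigenvector as (k & Hk & Hkv).
  (* M0 exceeds both / k, which bounds A, and 2, the norm of the identity; its square also covers
     A^2. *)
  set (M0 := / k + 2).
  assert (HM0 : 2 < M0) by (unfold M0; pose proof (Rinv_0_lt_compat k Hk); lra).
  set (M := M0 ^ 2). assert (HM : M0 <= M) by (unfold M; nra).
  exists (k / (4 * M)), M.
  split; [apply Rdiv_lt_0_compat; lra|split; [lra|]].
  intros v u1 u2. destruct (Hkv v) as (A & HA & HAn & HAw).
  set (w := fun i : nat => match i with O => v | 1%nat => mat_vec A v | _ => mat_vec (mat_mul A A) v end).
  set (g := fun i : nat => match i with O => mat_one | 1%nat => A | _ => mat_mul A A end).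
  assert (Hgw : forall i, mat_vec (g i) v = w i).
  { intros [|[|i]]; simpl; auto. apply mat_vec_one. }
  assert (HGg : forall i, G (g i)).
  { intros [|[|i]]; simpl; try apply (G_mul G HG); try apply (G_one G HG); assumption. }
  assert (HgM : forall i, mat_norm (g i) <= M).
  { intros [|[|i]]; simpl.
    - unfold mat_norm; simpl. rewrite !Rabs_R0, !Rabs_R1. lra.
    - unfold M0 in *; lra.
    - eapply Rle_trans; [apply mat_norm_mul|]. pose proof (mat_norm_pos A).
      unfold M. simpl. rewrite Rmult_1_r. apply Rmult_le_compat; unfold M0 in *; lra. }
  assert (HwM : forall i, vec_norm (w i) <= M * vec_norm v).
  { intros i. rewrite <- Hgw. eapply Rle_trans; [apply vec_norm_mat_vec|].
    apply Rmult_le_compat_r; [apply vec_norm_pos|apply HgM]. }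
  assert (Hchoice : forall i, (k / (4 * M) * vec_norm u1 * vec_norm v <= Rabs (wedge u1 (w i)) /\
      k / (4 * M) * vec_norm u2 * vec_norm v <= Rabs (wedge u2 (w i))) ->
      exists B, G B /\ mat_norm B <= M /\
      k / (4 * M) * vec_norm u1 * vec_norm v <= Rabs (wedge u1 (mat_vec B v)) /\
      k / (4 * M) * vec_norm u2 * vec_norm v <= Rabs (wedge u2 (mat_vec B v))).
  { intros i [Hi1 Hi2]. exists (g i). rewrite Hgw. auto. }
  destruct (vec_norm_pos v) as [Hv|Hv].
  2:{ apply (Hchoice 0%nat). rewrite <- Hv, !Rmult_0_r. split; apply Rabs_pos. }
  assert (HA1 : ~ eq_PSL A mat_one).
  { assert (0 < k * vec_norm v ^ 2) by (apply Rmult_lt_0_compat; [assumption|now apply pow_lt]).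
    intros [E|E]; rewrite E in HAw; unfold wedge, mat_vec in HAw; destruct v as [x y]; simpl in HAw.
    - replace (_ - _) with 0 in HAw by ring. rewrite Rabs_R0 in HAw.
      unfold vec_norm in *; simpl in *; lra.
    - replace (_ - _) with 0 in HAw by ring. rewrite Rabs_R0 in HAw.
      unfold vec_norm in *; simpl in *; lra. }
  pose proof (hyperbolic_of_nontrivial G HG HD HF HC A HA HA1) as Htr.
  pose proof (G_det G HG A HA) as DA.
  assert (W01 : k * vec_norm v ^ 2 <= Rabs (wedge (w 0%nat) (w 1%nat))) by exact HAw.
  assert (W12 : k * vec_norm v ^ 2 <= Rabs (wedge (w 1%nat) (w 2%nat))).
  { replace (wedge (w 1%nat) (w 2%nat)) with (mat_det A * wedge v (mat_vec A v));
      [rewrite DA, Rmult_1_l; exact HAw|].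
    unfold wedge, mat_det; simpl. ring. }
  (* By Cayley-Hamilton A^2 v = tr(A) A v - v, and |tr A| > 2 as A is hyperbolic. *)
  assert (W02 : k * vec_norm v ^ 2 <= Rabs (wedge (w 0%nat) (w 2%nat))).
  { replace (wedge (w 0%nat) (w 2%nat)) with (mat_tr A * wedge v (mat_vec A v)).
    - rewrite Rabs_mult. pose proof (Rabs_pos (wedge v (mat_vec A v))). nra.
    - unfold wedge, mat_tr; simpl. ring. }
  assert (Hone : forall u i j, k * vec_norm v ^ 2 <= Rabs (wedge (w i) (w j)) ->
    Rabs (wedge u (w i)) < k / (4 * M) * vec_norm u * vec_norm v ->
    Rabs (wedge u (w j)) < k / (4 * M) * vec_norm u * vec_norm v -> False).
  { intros u i j Hij Hi Hj. destruct (vec_norm_pos u) as [Hu|Hu].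
    - apply (wedge_dichotomy u (w i) (w j) k M (vec_norm v)); auto; lra.
    - rewrite <- Hu, Rmult_0_r, Rmult_0_l in Hi. pose proof (Rabs_pos (wedge u (w i))). lra. }
  set (bad := fun u i => Rabs (wedge u (w i)) < k / (4 * M) * vec_norm u * vec_norm v).
  assert (Hdec : forall u i, bad u i \/ k / (4 * M) * vec_norm u * vec_norm v <= Rabs (wedge u (w i))).
  { intros u i. unfold bad.
    destruct (Rlt_le_dec (Rabs (wedge u (w i))) (k / (4 * M) * vec_norm u * vec_norm v));
      tauto. }
  destruct (Hdec u1 0%nat) as [B10|B10], (Hdec u2 0%nat) as [B20|B20],
    (Hdec u1 1%nat) as [B11|B11], (Hdec u2 1%nat) as [B21|B21],
    (Hdec u1 2%nat) as [B12|B12], (Hdec u2 2%nat) as [B22|B22];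
    solve [ apply (Hchoice 0%nat); tauto | apply (Hchoice 1%nat); tauto | apply (Hchoice 2%nat); tauto
          | exfalso; eauto ].
Qed.

End NonElementary.

(** * Ping-pong *)

Lemma vec_eq (v w : R * R) : fst v = fst w -> snd v = snd w -> v = w.
Proof. destruct v, w; simpl; intros; now subst. Qed.

(** [pusher eta W a g]: as a Moebius map of the boundary circle, [g] sends the complement of
    [(a - eta, a + eta)] into [{|x| >= 1 / eta}], expanding there. *)
Record pusher (eta W a : R) (g : mat2) : Prop := {
  pusher_image : forall v, eta * Rabs (snd v) <= Rabs (fst v - a * snd v) ->
    Rabs (snd (mat_vec g v)) <= eta * Rabs (fst (mat_vec g v));
  pusher_expand : forall v, Rabs (snd v) <= eta * Rabs (fst v) ->
    2 * Rabs (fst v) <= Rabs (fst (mat_vec g v));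
  pusher_inv : forall v, Rabs (fst v) <= (W + 1) * Rabs (snd v) ->
    Rabs (fst (mat_vec (mat_inv g) v)) <= (W + 1) * Rabs (snd (mat_vec (mat_inv g) v)) /\
    2 * Rabs (snd v) <= Rabs (snd (mat_vec (mat_inv g) v)) }.

Lemma Rabs_add_le a b x y : Rabs a <= x -> Rabs b <= y -> Rabs (a + b) <= x + y.
Proof. intros. pose proof (Rabs_triang a b). lra. Qed.

Lemma Rabs_add_ge a b x y : x <= Rabs a -> Rabs b <= y -> x - y <= Rabs (a + b).
Proof.
  intros. pose proof (Rabs_triang_inv a (- b)) as H1. rewrite Rabs_Ropp in H1.
  replace (a - - b) with (a + b) in H1 by ring. lra.
Qed.

Lemma Rabs_mul_le a b x y : Rabs a <= x -> Rabs b <= y -> Rabs (a * b) <= x * y.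
Proof. intros. rewrite Rabs_mult. apply Rmult_le_compat; auto; apply Rabs_pos. Qed.

Lemma Rabs_mul_ge a b x y : 0 <= x -> 0 <= y -> x <= Rabs a -> y <= Rabs b -> x * y <= Rabs (a * b).
Proof. intros. rewrite Rabs_mult. apply Rmult_le_compat; auto. Qed.

(** The matrix is U T V^-1 with T = (t_ij), U the map z -> z / e and V the map z -> e z + a. In
    terms of u = x - a y it sends (x, y) to (t11 u / e + t12 y, t21 u + e t22 y). The lower bound on
    |t11| makes t11 / e dominate everything else; e is chosen so that eta |t11| / e >= 4 C. *)
Lemma pusher_of_entries c C W eta a t11 t12 t21 t22 :
  0 < c <= 1 -> 1 <= C -> 1 <= W -> 0 < eta -> eta * (2 * (W + 1)) <= 1 -> Rabs a <= W ->
  c <= Rabs t11 <= C -> Rabs t12 <= C -> Rabs t21 <= C -> Rabs t22 <= C ->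
  let e := c / (4 * C) * eta in
  pusher eta W a (Mat2 (t11 / e) (t12 - a * (t11 / e)) t21 (e * t22 - a * t21)).
Proof.
  intros Hc HC HW Heta HetaW Ha [H11 H11'] H12 H21 H22 e.
  assert (He : 0 < e) by (apply Rmult_lt_0_compat; [apply Rdiv_lt_0_compat; lra|lra]).
  assert (Hee : e <= eta).
  { unfold e. rewrite <- (Rmult_1_l eta) at 2. apply Rmult_le_compat_r; [lra|].
    apply Rle_div_l; lra. }
  set (p := t11 / e).
  assert (Hp : 4 * C <= eta * Rabs p).
  { unfold p, Rdiv. rewrite Rabs_mult, Rabs_inv, (Rabs_pos_eq e) by lra.
    replace (4 * C) with (eta * (c * / e)).
    - apply Rmult_le_compat_l; [lra|]. apply Rmult_le_compat_r; [|assumption].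
      left; now apply Rinv_0_lt_compat.
    - unfold e. field. lra. }
  assert (HpB : 4 * C * (2 * (W + 1)) <= Rabs p).
  { pose proof (Rabs_pos p). nra. }
  constructor; intros [x y]; unfold mat_vec; cbn [fst snd m11 m12 m21 m22 mat_inv]; intros H;
    pose proof (Rabs_pos x) as Px; pose proof (Rabs_pos y) as Py; pose proof (Rabs_pos p) as Pp.
  - set (u := x - a * y) in *. pose proof (Rabs_pos u) as Pu.
    replace (p * x + (t12 - a * p) * y) with (p * u + t12 * y) by (unfold u; ring).
    replace (t21 * x + (e * t22 - a * t21) * y) with (t21 * u + t22 * (e * y)) by (unfold u; ring).
    assert (Hey : Rabs (e * y) <= Rabs u) by (rewrite Rabs_mult, (Rabs_pos_eq e) by lra; nra).
    pose proof (Rabs_add_le _ _ _ _ (Rabs_mul_le t21 u C (Rabs u) H21 (Rle_refl _))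
      (Rabs_mul_le t22 (e * y) C (Rabs u) H22 Hey)) as H1.
    pose proof (Rabs_add_ge (p * u) (t12 * y) (Rabs p * Rabs u) (C * Rabs y)) as H2.
    rewrite Rabs_mult in H2. specialize (H2 (Rle_refl _) (Rabs_mul_le _ _ _ _ H12 (Rle_refl _))).
    apply (Rmult_le_compat_l eta) in H2; [|lra].
    assert (4 * C * Rabs u <= eta * Rabs p * Rabs u) by (apply Rmult_le_compat_r; lra).
    assert (C * (eta * Rabs y) <= C * Rabs u) by (apply Rmult_le_compat_l; lra).
    assert (0 <= C * Rabs u) by (apply Rmult_le_pos; lra).
    lra.
  - replace (p * x + (t12 - a * p) * y) with (p * (x + - (a * y)) + t12 * y) by ring.
    assert (Hay : Rabs (- (a * y)) <= Rabs x / 2).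
    { rewrite Rabs_Ropp. eapply Rle_trans; [apply (Rabs_mul_le _ _ _ _ Ha H)|]. nra. }
    pose proof (Rabs_add_ge _ _ _ _ (Rle_refl (Rabs x)) Hay) as H1.
    assert (H2 : 4 * C * (2 * (W + 1)) * (Rabs x / 2) <= Rabs (p * (x + - (a * y)))).
    { apply Rabs_mul_ge; [nra|lra|assumption|lra]. }
    pose proof (Rabs_add_ge _ _ _ _ H2 (Rabs_mul_le _ _ _ _ H12 H)) as H3.
    assert (eta <= 1) by nra.
    assert (eta * Rabs x <= Rabs x) by nra.
    assert (C * (eta * Rabs x) <= C * Rabs x) by (apply Rmult_le_compat_l; lra).
    assert (4 * (C * Rabs x) <= 4 * C * (2 * (W + 1)) * (Rabs x / 2)) by nra.
    assert (1 * Rabs x <= C * Rabs x) by (apply Rmult_le_compat_r; lra).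
    lra.
  - set (x' := (e * t22 - a * t21) * x + - (t12 - a * p) * y).
    set (y' := - t21 * x + p * y).
    assert (Hy' : 3 * C * (W + 1) * Rabs y <= Rabs y').
    { unfold y'. replace (- t21 * x + p * y) with (p * y + - t21 * x) by ring.
      assert (H1 : Rabs (- t21 * x) <= C * ((W + 1) * Rabs y))
        by (apply Rabs_mul_le; [now rewrite Rabs_Ropp|assumption]).
      assert (H2 : 4 * C * (2 * (W + 1)) * Rabs y <= Rabs (p * y))
        by (apply Rabs_mul_ge; [nra|lra|assumption|lra]).
      pose proof (Rabs_add_ge _ _ _ _ H2 H1).
      assert (0 <= C * (W + 1) * Rabs y) by (repeat apply Rmult_le_pos; lra). lra. }
    assert (HCy : 0 <= C * Rabs y) by (apply Rmult_le_pos; lra).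
    assert (Hdiff : Rabs (x' + - (a * y')) <= 2 * C * Rabs y).
    { replace (x' + - (a * y')) with (t22 * (e * x) + - t12 * y) by (unfold x', y'; ring).
      assert (H1 : Rabs (e * x) <= Rabs y).
      { rewrite Rabs_mult, (Rabs_pos_eq e) by lra. nra. }
      pose proof (Rabs_mul_le _ _ _ _ H22 H1).
      assert (Rabs (- t12 * y) <= C * Rabs y) by (apply Rabs_mul_le; [now rewrite Rabs_Ropp|lra]).
      eapply Rle_trans; [now apply Rabs_add_le; eassumption|]. lra. }
    assert (HCWy : C * Rabs y <= C * Rabs y * (W + 1)) by nra.
    assert (H1C : 1 * Rabs y <= C * Rabs y) by (apply Rmult_le_compat_r; lra).
    split; [|nra].
    assert (Hx' : Rabs x' <= Rabs (x' + - (a * y')) + Rabs (a * y')).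
    { replace x' with ((x' + - (a * y')) + a * y') at 1 by ring. apply Rabs_triang. }
    assert (Rabs (a * y') <= W * Rabs y') by (apply Rabs_mul_le; lra).
    nra.
Qed.

(** * Dynamics of products of pushers *)

Definition mat_prod (l : list mat2) : mat2 := fold_right mat_mul mat_one l.

Lemma mat_prod_app l1 l2 : mat_prod (l1 ++ l2) = mat_mul (mat_prod l1) (mat_prod l2).
Proof.
  induction l1 as [|g l1 IH]; simpl.
  - now rewrite mat_mul_1_l.
  - rewrite IH. apply mat_mul_assoc.
Qed.

(** The factor 2 is [mat_norm mat_one]. *)
Lemma mat_prod_norm l K : 0 <= K -> (forall g, In g l -> mat_norm g <= K) ->
  mat_norm (mat_prod l) <= 2 * K ^ length l.
Proof.
  intros HK. induction l as [|g l IH]; intros Hl; simpl.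
  - unfold mat_norm; simpl. rewrite Rabs_R0, Rabs_R1. lra.
  - eapply Rle_trans; [apply mat_norm_mul|].
    apply Rle_trans with (K * (2 * K ^ length l)); [|lra].
    apply Rmult_le_compat; try apply mat_norm_pos; [apply Hl; now left|].
    apply IH. intros; apply Hl; now right.
Qed.

Section Products.
Context (eta W : R) (Heta : 0 < eta) (HW : 1 <= W) (HetaW : eta * (2 * (W + 1)) <= 1).

Lemma pusher_image_of_target a g v : pusher eta W a g -> Rabs a <= W ->
  Rabs (snd v) <= eta * Rabs (fst v) ->
  Rabs (snd (mat_vec g v)) <= eta * Rabs (fst (mat_vec g v)).
Proof.
  intros Hg Ha H. apply (pusher_image _ _ _ _ Hg).
  pose proof (Rabs_pos (fst v)). pose proof (Rabs_pos (snd v)).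
  assert (Hb : Rabs (- (a * snd v)) <= W * (eta * Rabs (fst v)))
    by (rewrite Rabs_Ropp; now apply Rabs_mul_le).
  pose proof (Rabs_add_ge _ _ _ _ (Rle_refl (Rabs (fst v))) Hb). unfold Rminus.
  assert (eta <= / 4) by nra. nra.
Qed.

Lemma pushers_forward l v : (forall g, In g l -> exists a, Rabs a <= W /\ pusher eta W a g) ->
  Rabs (snd v) <= eta * Rabs (fst v) ->
  Rabs (snd (mat_vec (mat_prod l) v)) <= eta * Rabs (fst (mat_vec (mat_prod l) v)) /\
  Rabs (fst v) <= Rabs (fst (mat_vec (mat_prod l) v)).
Proof.
  induction l as [|g l IH]; intros Hl Hv; simpl mat_prod.
  - rewrite mat_vec_one. split; [assumption|lra].
  - destruct IH as [H1 H2]; [intros; apply Hl; now right|assumption|].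
    destruct (Hl g (or_introl eq_refl)) as (a & Ha & Hg).
    rewrite mat_vec_mul. split; [eapply pusher_image_of_target; eassumption|].
    pose proof (pusher_expand _ _ _ _ Hg _ H1).
    pose proof (Rabs_pos (fst (mat_vec (mat_prod l) v))). lra.
Qed.

(** The interval [-(W + 1), W + 1] contains every repelling interval and is stable under all the
    inverses, so the estimates chain without knowing the order of the factors. *)
Lemma pushers_backward l v : (forall g, In g l -> exists a, Rabs a <= W /\ pusher eta W a g) ->
  Rabs (fst v) <= (W + 1) * Rabs (snd v) ->
  let v' := mat_vec (mat_inv (mat_prod l)) v in
  Rabs (fst v') <= (W + 1) * Rabs (snd v') /\ Rabs (snd v) <= Rabs (snd v').
Proof.
  revert v. induction l as [|g l IH]; intros v Hl Hv v'; unfold v'; simpl mat_prod.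
  - replace (mat_inv mat_one) with mat_one by mat_solve. rewrite mat_vec_one. split; [assumption|lra].
  - rewrite mat_inv_mul, mat_vec_mul.
    destruct (Hl g (or_introl eq_refl)) as (a & Ha & Hg).
    destruct (pusher_inv _ _ _ _ Hg v Hv) as [H1 H2].
    destruct (IH (mat_vec (mat_inv g) v)) as [H3 H4]; [intros; apply Hl; now right|assumption|].
    split; [assumption|]. pose proof (Rabs_pos (snd v)). lra.
Qed.

(** Here g acts first. An eigendirection away from a is thrown near infinity by g and kept there,
    stretched, by the other factors; being invariant, it was already there. An eigendirection near a
    is stretched by the inverse product, so its eigenvalue is small. *)
Lemma pushers_eigenvector l a g v lam :
  (forall h, In h l -> exists a, Rabs a <= W /\ pusher eta W a h) ->
  Rabs a <= W -> pusher eta W a g -> mat_det (mat_mul (mat_prod l) g) = 1 ->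
  v <> (0, 0) -> mat_vec (mat_mul (mat_prod l) g) v = (lam * fst v, lam * snd v) ->
  (Rabs (fst v - a * snd v) < eta * Rabs (snd v) /\ Rabs lam < 1) \/
  (Rabs (snd v) <= eta * Rabs (fst v) /\ 1 < Rabs lam).
Proof.
  intros Hl Ha Hg HQ Hv Hlam.
  assert (Hback : mat_vec (mat_inv (mat_mul (mat_prod l) g)) (lam * fst v, lam * snd v) = v).
  { rewrite <- Hlam, <- mat_vec_mul, mat_inv_l by exact HQ. apply mat_vec_one. }
  assert (Hlam0 : lam <> 0).
  { intros E. apply Hv. rewrite <- Hback, E. unfold mat_vec; simpl. f_equal; ring. }
  pose proof (Rabs_pos_lt lam Hlam0) as Hlam1.
  assert (Hv0 : fst v <> 0 \/ snd v <> 0).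
  { apply NNPP; intros E. apply Hv. apply vec_eq; simpl; apply NNPP; tauto. }
  destruct v as [x y]. cbn [fst snd] in *.
  pose proof (Rabs_pos x). pose proof (Rabs_pos y).
  assert (eta <= / 4) by nra.
  destruct (Rlt_le_dec (Rabs (x - a * y)) (eta * Rabs y)) as [L|L]; [left|right].
  - split; [exact L|].
    assert (Hxy : Rabs x <= (W + 1) * Rabs y).
    { assert (Rabs (a * y) <= W * Rabs y) by (apply Rabs_mul_le; lra).
      replace x with ((x - a * y) + a * y) by ring.
      eapply Rle_trans; [apply Rabs_triang|]. nra. }
    destruct (pushers_backward l (x, y) Hl Hxy) as [B1 B2].
    destruct (pusher_inv _ _ _ _ Hg _ B1) as [_ B3].
    rewrite <- mat_vec_mul, <- mat_inv_mul in B3.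
    assert (E : snd (mat_vec (mat_inv (mat_mul (mat_prod l) g)) (x, y)) * lam = y).
    { apply (f_equal snd) in Hback. unfold mat_vec in *. cbn [fst snd] in *.
      etransitivity; [|exact Hback]. ring. }
    cbn [snd] in B2.
    assert (Hy : 0 < Rabs y).
    { pose proof (Rabs_pos (x - a * y)). nra. }
    apply (f_equal Rabs) in E. rewrite Rabs_mult in E. nra.
  - pose proof (pusher_image _ _ _ _ Hg (x, y) L) as H2.
    destruct (pushers_forward l _ Hl H2) as [H3 H4].
    rewrite <- mat_vec_mul, Hlam in H3, H4. cbn [fst snd] in H3, H4.
    rewrite (Rabs_mult lam y) in H3. rewrite (Rabs_mult lam x) in H3, H4.
    assert (H5 : Rabs y <= eta * Rabs x) by (apply Rmult_le_reg_l with (Rabs lam); lra).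
    split; [exact H5|].
    pose proof (pusher_expand _ _ _ _ Hg (x, y) H5) as H6. cbn [fst] in H6.
    assert (0 < Rabs x).
    { apply Rabs_pos_lt. intros E. rewrite E, Rabs_R0, Rmult_0_r in H5.
      destruct Hv0 as [E'|E']; [contradiction|]. pose proof (Rabs_pos_lt y E'). lra. }
    apply Rmult_lt_reg_r with (Rabs x); lra.
Qed.

End Products.

(** * Diagonalization of hyperbolic elements *)

Definition mat_diag (x : R) : mat2 := Mat2 x 0 0 (/ x).

(** By Cayley-Hamilton (P - / lam) w and (P - lam) w are eigenvectors for lam and / lam, independent
    since w is not an eigenvector; dividing the second by q normalizes the determinant. *)
Lemma hyperbolic_diagonalization P w : mat_det P = 1 -> 2 < Rabs (mat_tr P) ->
  wedge w (mat_vec P w) <> 0 ->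
  exists N lam, mat_det N = 1 /\ 1 < Rabs lam <= Rabs (mat_tr P) /\
    mat_mul P N = mat_mul N (mat_diag lam).
Proof.
  intros HP Htr Hw. set (t := mat_tr P) in *.
  assert (Hlam : exists lam, 1 < Rabs lam <= Rabs t /\ lam + / lam = t /\ lam - / lam <> 0).
  { assert (Hpos : forall s, 2 < s -> exists lam, 1 < lam <= s /\ lam + / lam = s /\ 0 < lam - / lam).
    { intros s Hs. set (r := sqrt (s ^ 2 - 4)).
      assert (Hr : 0 < r) by (apply sqrt_lt_R0; nra).
      assert (Hr2 : r * r = s ^ 2 - 4) by (apply sqrt_sqrt; nra).
      assert (Hi : / ((s + r) / 2) = (s - r) / 2).
      { apply Rmult_eq_reg_l with ((s + r) / 2); [|lra]. rewrite Rinv_r by lra. nra. }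
      exists ((s + r) / 2). rewrite Hi. repeat split; try lra. nra. }
    destruct (Rlt_le_dec 0 t) as [L|L].
    - rewrite Rabs_pos_eq in * by lra. destruct (Hpos t Htr) as (lam & H1 & H2 & H3).
      exists lam. rewrite Rabs_pos_eq by lra. repeat split; lra.
    - rewrite (Rabs_left1 t) in * by lra. destruct (Hpos (- t) Htr) as (lam & H1 & H2 & H3).
      exists (- lam). rewrite Rabs_Ropp, Rabs_pos_eq, Rinv_opp by lra. repeat split; lra. }
  destruct Hlam as (lam & Hl1 & Hl2 & Hl3).
  assert (Hl0 : lam <> 0) by (intros E; rewrite E, Rabs_R0 in Hl1; lra).
  set (mu := / lam) in *. assert (Hlm : lam * mu = 1) by (unfold mu; now field).
  set (q := (lam - mu) * wedge w (mat_vec P w)).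
  assert (Hq : q <> 0) by now apply Rmult_integral_contrapositive.
  destruct P as [a b c d]; destruct w as [x y].
  unfold t, mat_tr, mat_det, wedge, mat_vec in *; simpl in *.
  exists (Mat2 (a * x + b * y - mu * x) ((a * x + b * y - lam * x) / q)
               (c * x + d * y - mu * y) ((c * x + d * y - lam * y) / q)), lam.
  split; [|split; [exact Hl1|]].
  - unfold mat_det; simpl. rewrite <- (Rinv_r q) by assumption.
    transitivity (((lam - mu) * (x * (c * x + d * y) - y * (a * x + b * y))) / q);
      [field; exact Hq|reflexivity].
  - fold mu. unfold mat_diag. fold mu.
    assert (Ed : d = lam + mu - a) by lra.
    assert (Ebc : b * c = a * d - lam * mu) by lra.
    apply mat_ext; simpl.
    + transitivity (a * (a * x) + a * (b * y) - a * mu * x + (b * c) * x + b * d * y - b * mu * y); [ring|].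
      rewrite Ebc, Ed. ring.
    + transitivity ((a * (a * x) + a * (b * y) - a * lam * x + (b * c) * x + b * d * y - b * lam * y) / q);
        [field; exact Hq|].
      rewrite Ebc, Ed. field. exact Hq.
    + transitivity (c * a * x + (b * c) * y - c * mu * x + d * (c * x) + d * (d * y) - d * mu * y); [ring|].
      rewrite Ebc, Ed. ring.
    + transitivity ((c * a * x + (b * c) * y - c * lam * x + d * (c * x) + d * (d * y) - d * lam * y) / q);
        [field; exact Hq|].
      rewrite Ebc, Ed. field. exact Hq.
Qed.

(** * Construction of pushers from cocompactness *)

(** The image of i determines X up to a rotation: c^2 + d^2 = 1 / Im (X i) and a^2 + b^2 = |X i|^2
    (c^2 + d^2). *)
Lemma box_matrix_norm B X : 1 <= B -> mat_det X = 1 -> in_box B (mobius X (0, 1)) ->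
  mat_norm X <= 8 * B ^ 2.
Proof.
  intros HB HX [H1 [H2 H3]].
  assert (Hi : in_H (0, 1)) by (unfold in_H; simpl; lra).
  pose proof (auto_factor_pos X _ HX Hi) as Hq.
  rewrite mobius_Re in H1 by assumption. rewrite mobius_Im in H2, H3 by assumption.
  set (q := auto_factor X (0, 1)) in *.
  unfold mat_det in HX. destruct X as [a b c d]; cbn [m11 m12 m21 m22] in *.
  assert (Eq : q = d ^ 2 + c ^ 2) by (unfold q, auto_factor; simpl; ring).
  simpl Re in H1. simpl Im in *.
  set (x := ((a * 0 + b) * (c * 0 + d) + a * c * 1 ^ 2) / q) in *.
  set (y := 1 / q) in *.
  assert (Exy : a ^ 2 + b ^ 2 = (x ^ 2 + y ^ 2) * q).
  { unfold x, y.
    transitivity (((b * d + a * c) ^ 2 + (a * d - b * c) ^ 2) / q); [rewrite Eq; field; lra|].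
    rewrite HX. field. lra. }
  assert (Hy : y * q = 1) by (unfold y; field; lra).
  assert (HqB : q <= B).
  { apply (Rmult_le_compat_l (B * q)) in H2; [|nra].
    replace (B * q * / B) with q in H2 by (field; lra). nra. }
  assert (0 <= y) by (unfold y; apply Rdiv_le_0_compat; lra).
  assert (Hx2 : x ^ 2 <= B ^ 2) by (apply pow_maj_Rabs; lra).
  assert (Hy2 : y ^ 2 <= B ^ 2) by (apply pow_incr; lra).
  pose proof (pow2_ge_0 a); pose proof (pow2_ge_0 b); pose proof (pow2_ge_0 c); pose proof (pow2_ge_0 d).
  pose proof (pow2_ge_0 x). pose proof (pow2_ge_0 y).
  assert (HB2 : 1 <= B ^ 2) by nra. assert (HB1 : B <= B ^ 2) by nra.
  assert (Hab : a ^ 2 + b ^ 2 <= 2 * B ^ 2 * B ^ 2).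
  { rewrite Exy. apply Rmult_le_compat; lra. }
  assert (Hcd : d ^ 2 + c ^ 2 <= 2 * B ^ 2 * B ^ 2) by nra.
  assert (T : forall t, t ^ 2 <= 2 * B ^ 2 * B ^ 2 -> Rabs t <= 2 * B ^ 2).
  { intros t Ht. apply Rabs_le_of_sqr; [lra|]. nra. }
  unfold mat_norm; cbn [m11 m12 m21 m22].
  pose proof (T a); pose proof (T b); pose proof (T c); pose proof (T d). lra.
Qed.

(** The determinant 1 is at most the product of the two column norms, each of which is at most E. *)
Lemma mat_column_norm_lower X E : mat_det X = 1 -> 0 < E -> mat_norm X <= E ->
  / E <= vec_norm (m11 X, m21 X) /\ / E <= vec_norm (m12 X, m22 X).
Proof.
  intros HX HE HN.
  set (u := vec_norm (m11 X, m21 X)). set (v := vec_norm (m12 X, m22 X)).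
  assert (Huv : u + v <= E) by (unfold u, v, vec_norm, mat_norm in *; simpl; lra).
  pose proof (vec_norm_pos (m11 X, m21 X)) as Hu. pose proof (vec_norm_pos (m12 X, m22 X)) as Hv.
  fold u in Hu. fold v in Hv.
  assert (1 <= u * v).
  { rewrite <- Rabs_R1, <- HX. unfold mat_det, Rminus.
    eapply Rle_trans; [apply Rabs_triang|]. rewrite Rabs_Ropp, !Rabs_mult.
    unfold u, v, vec_norm; simpl.
    pose proof (Rabs_pos (m11 X)); pose proof (Rabs_pos (m12 X));
    pose proof (Rabs_pos (m21 X)); pose proof (Rabs_pos (m22 X)). nra. }
  assert (T : forall s t, 0 <= s -> 0 <= t -> t <= E -> 1 <= s * t -> / E <= s).
  { intros s t Hs Ht HtE Hst. apply Rmult_le_reg_l with E; [assumption|].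
    rewrite Rinv_r by lra. nra. }
  split; [apply T with v|apply T with u]; try assumption; lra.
Qed.

Section Connecting.
Context (G : mat2 -> Prop) (HG : subgroup_PSL G) (HD : discrete G)
  (HF : acts_freely G) (HC : compact_quotient G).

(* [U] and [V] carry [i] to points at distance about [log (1 / eta)] in the directions of
   infinity and of [a]; cocompactness brings both back to a bounded region, where
   [uniform_separation] provides the missing group element. *)
Lemma pushers_exist W : 1 <= W -> exists K, 1 <= K /\ forall eta a,
  0 < eta -> eta * (2 * (W + 1)) <= 1 -> Rabs a <= W ->
  exists g, G g /\ pusher eta W a g /\ mat_norm g <= K / eta.
Proof.
  intros HW.
  destruct (cocompact_box G HG HC) as (B & HB & Hbox).
  destruct (uniform_separation G HG HD HF HC) as (c0 & M & Hc0 & HM & Hsep).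
  set (E := 8 * B ^ 2). assert (HE : 1 <= E) by (unfold E; nra).
  set (c := Rmin 1 (c0 * / E * / E)).
  assert (HiE : 0 < / E) by (apply Rinv_0_lt_compat; lra).
  assert (Hc : 0 < c <= 1).
  { split; [|apply Rmin_l]. apply Rmin_pos; [lra|]. repeat apply Rmult_lt_0_compat; assumption. }
  assert (Hcc : c <= c0 * / E * / E) by apply Rmin_r.
  set (C := E * M * E).
  assert (HCC : 1 <= C) by (unfold C; assert (1 <= E * M) by nra; nra).
  set (kap := c / (4 * C)).
  assert (Hkap : 0 < kap <= 1).
  { split; [apply Rdiv_lt_0_compat; lra|]. apply Rle_div_l; lra. }
  set (K := C / kap + (C + W * (C / kap)) + C + (C + W * C)).
  assert (HCk : 1 <= C / kap) by (apply Rle_div_r; lra).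
  exists K. split; [unfold K; nra|].
  intros eta a Heta HetaW Ha.
  set (e := kap * eta). assert (He : 0 < e) by (apply Rmult_lt_0_compat; lra).
  set (r := sqrt e). assert (Hr : 0 < r) by now apply sqrt_lt_R0.
  assert (Hrr : r * r = e) by (apply sqrt_sqrt; lra).
  set (U := Mat2 (/ r) 0 0 r). set (V := Mat2 r (a / r) 0 (/ r)).
  assert (DU : mat_det U = 1) by (unfold mat_det; simpl; field; lra).
  assert (DV : mat_det V = 1) by (unfold mat_det; simpl; field; lra).
  assert (Hi : in_H (0, 1)) by (unfold in_H; simpl; lra).
  destruct (Hbox (mobius U (0, 1))) as (A1 & HA1 & HX); [now apply mobius_in_H|].
  destruct (Hbox (mobius V (0, 1))) as (A2 & HA2 & HY); [now apply mobius_in_H|].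
  pose proof (G_det G HG A1 HA1) as DA1. pose proof (G_det G HG A2 HA2) as DA2.
  rewrite <- mobius_mul in HX, HY by assumption.
  set (X := mat_mul A1 U) in *. set (Y := mat_mul A2 V) in *.
  assert (DX : mat_det X = 1) by (unfold X; rewrite mat_det_mul, DA1, DU; ring).
  assert (DY : mat_det Y = 1) by (unfold Y; rewrite mat_det_mul, DA2, DV; ring).
  apply box_matrix_norm in HX, HY; try assumption. fold E in HX, HY.
  destruct (mat_column_norm_lower X E DX) as [X1 X2]; [lra|assumption|].
  destruct (mat_column_norm_lower Y E DY) as [Y1 Y2]; [lra|assumption|].
  (* Up to sign, the upper left entry of X^-1 g0 Y is the wedge of the second column of X with the
     image of the first column of Y; keeping it away from 0 is what [pusher_of_entries] requires. *)
  destruct (Hsep (m11 Y, m21 Y) (m12 X, m22 X) (m11 X, m21 X)) as (g0 & Hg0 & Hg0n & S1 & S2).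
  set (T := mat_mul (mat_mul (mat_inv X) g0) Y).
  assert (HTn : mat_norm T <= C).
  { unfold T, C. eapply Rle_trans; [apply mat_norm_mul|].
    apply Rmult_le_compat; try apply mat_norm_pos; [|assumption].
    eapply Rle_trans; [apply mat_norm_mul|].
    apply Rmult_le_compat; try apply mat_norm_pos; [|assumption].
    now rewrite mat_norm_inv. }
  assert (Hlow : forall u, / E <= vec_norm u ->
    c0 * vec_norm u * vec_norm (m11 Y, m21 Y) <= Rabs (wedge u (mat_vec g0 (m11 Y, m21 Y))) ->
    c <= Rabs (wedge u (mat_vec g0 (m11 Y, m21 Y)))).
  { intros u Hu H. eapply Rle_trans; [exact Hcc|]. eapply Rle_trans; [|exact H].
    apply Rmult_le_compat; try lra; [nra|]. apply Rmult_le_compat_l; lra. }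
  assert (HT11 : c <= Rabs (m11 T)).
  { replace (m11 T) with (- wedge (m12 X, m22 X) (mat_vec g0 (m11 Y, m21 Y)))
      by (unfold wedge, mat_vec, T; simpl; ring).
    rewrite Rabs_Ropp. now apply Hlow. }
  destruct (mat_norm_entries T) as (T1 & T2 & T3 & T4).
  set (g := Mat2 (m11 T / e) (m12 T - a * (m11 T / e)) (m21 T) (e * m22 T - a * m21 T)).
  (* g is U T V^-1; U and V, which are not in [G], cancel against those inside X and Y. *)
  assert (Hg : g = mat_mul (mat_inv A1) (mat_mul g0 A2)).
  { transitivity (mat_mul (mat_mul U T) (mat_inv V)).
    - unfold g. rewrite <- Hrr. clearbody T r. apply mat_ext; simpl; field; lra.
    - unfold T, X, Y. rewrite mat_inv_mul, <- !mat_mul_assoc, mat_inv_r, mat_mul_1_r by assumption.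
      now rewrite mat_mul_inv_l. }
  exists g. split; [|split].
  - rewrite Hg. apply (G_mul G HG); [now apply (G_inv G HG)|now apply (G_mul G HG)].
  - apply (pusher_of_entries c C W eta a); auto; lra.
  - unfold mat_norm, g; cbn [m11 m12 m21 m22].
    assert (Heta1 : eta <= 1) by nra.
    assert (Hie : 1 <= / eta).
    { rewrite <- Rinv_1. apply Rinv_le_contravar; lra. }
    assert (Hp : Rabs (m11 T / e) <= C / kap * / eta).
    { unfold Rdiv at 1. rewrite Rabs_mult, Rabs_inv, (Rabs_pos_eq e) by lra.
      replace (C / kap * / eta) with (C * / e) by (unfold e; field; lra).
      apply Rmult_le_compat_r; [|lra]. left; now apply Rinv_0_lt_compat. }
    assert (Hq : Rabs (m12 T - a * (m11 T / e)) <= (C + W * (C / kap)) * / eta).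
    { unfold Rminus. eapply Rle_trans; [apply Rabs_triang|]. rewrite Rabs_Ropp.
      pose proof (Rabs_mul_le _ _ _ _ Ha Hp). nra. }
    assert (Hs : Rabs (e * m22 T - a * m21 T) <= (C + W * C) * / eta).
    { unfold Rminus. eapply Rle_trans; [apply Rabs_triang|]. rewrite Rabs_Ropp.
      assert (H21 : Rabs (m21 T) <= C) by lra.
      pose proof (Rabs_mul_le _ _ _ _ Ha H21).
      assert (He1 : Rabs e <= 1) by (rewrite Rabs_pos_eq; unfold e; nra).
      assert (H22 : Rabs (m22 T) <= C) by lra.
      pose proof (Rabs_mul_le _ _ _ _ He1 H22).
      assert (0 <= W * C) by (apply Rmult_le_pos; lra).
      assert ((C + W * C) * 1 <= (C + W * C) * / eta) by (apply Rmult_le_compat_l; lra). lra. }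
    assert (Rabs (m21 T) <= C * / eta) by nra.
    unfold K, Rdiv at 1. lra.
Qed.

End Connecting.

(** * Axes *)

Definition axis (N : mat2) (t : R) : C := mobius N (0, exp t).

Lemma in_H_vertical y : 0 < y -> in_H (0, y).
Proof. now unfold in_H. Qed.

Lemma axis_in_H N t : mat_det N = 1 -> in_H (axis N t).
Proof. intros HN. apply mobius_in_H; [exact HN|]. apply in_H_vertical, exp_pos. Qed.

Lemma mobius_axis A N t : mat_det A = 1 -> mat_det N = 1 ->
  mobius A (axis N t) = axis (mat_mul A N) t.
Proof.
  intros HA HN. unfold axis. rewrite mobius_mul; auto. apply in_H_vertical, exp_pos.
Qed.

Lemma sinh_le x y : x <= y -> sinh x <= sinh y.
Proof. intros [H| ->]; [left; now apply sinh_lt|right; reflexivity]. Qed.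

Lemma sep_vertical s t : sep (0, exp s) (0, exp t) = (2 * sinh ((s - t) / 2)) ^ 2.
Proof.
  rewrite sep_coord. simpl Re. simpl Im.
  replace s with (s / 2 + s / 2) at 1 2 by field. replace t with (t / 2 + t / 2) at 1 2 by field.
  unfold sinh. replace ((s - t) / 2) with (s / 2 + - (t / 2)) by field.
  rewrite Ropp_plus_distr, Ropp_involutive, !exp_plus, !exp_Ropp.
  pose proof (exp_pos (s / 2)). pose proof (exp_pos (t / 2)). field. lra.
Qed.

Lemma dist_H_vertical s t : dist_H (0, exp s) (0, exp t) = Rabs (s - t).
Proof.
  assert (T : forall s t, t <= s -> dist_H (0, exp s) (0, exp t) = Rabs (s - t)).
  { intros a b Hab. rewrite dist_H_sep by (apply in_H_vertical, exp_pos).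
    pose proof (sinh_le 0 ((a - b) / 2)) as Hs. rewrite sinh_0 in Hs.
    rewrite sep_vertical, sqrt_pow2, Rabs_pos_eq by lra.
    replace (2 * sinh ((a - b) / 2) / 2) with (sinh ((a - b) / 2)) by field.
    rewrite arcsinh_sinh. field. }
  destruct (Rle_lt_dec t s) as [L|L]; [now apply T|].
  rewrite dist_H_sep, sep_sym, <- dist_H_sep, Rabs_minus_sym by (apply in_H_vertical, exp_pos).
  apply T. lra.
Qed.

Lemma axis_unit_speed N s t : mat_det N = 1 -> dist_H (axis N s) (axis N t) = Rabs (s - t).
Proof.
  intros HN. unfold axis. rewrite dist_H_mobius; auto using dist_H_vertical;
    apply in_H_vertical, exp_pos.
Qed.

Lemma mat_det_diag x : x <> 0 -> mat_det (mat_diag x) = 1.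
Proof. intros Hx. unfold mat_det; simpl. field. exact Hx. Qed.

Lemma mobius_diag x y : x <> 0 -> 0 < y -> mobius (mat_diag x) (0, y) = (0, x ^ 2 * y).
Proof.
  intros Hx Hy. pose proof (mat_det_diag x Hx). pose proof (in_H_vertical y Hy).
  apply C_ext; rewrite ?mobius_Re, ?mobius_Im by assumption;
    unfold auto_factor; simpl; field; repeat split; try lra.
Qed.

Lemma axis_translate P N x t : mat_det P = 1 -> mat_det N = 1 -> x <> 0 ->
  mat_mul P N = mat_mul N (mat_diag x) -> mobius P (axis N t) = axis N (t + 2 * ln (Rabs x)).
Proof.
  intros HP HN Hx E. rewrite mobius_axis, E by assumption. unfold axis.
  rewrite mobius_mul, mobius_diag by (auto using mat_det_diag, exp_pos; apply in_H_vertical, exp_pos).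
  f_equal. f_equal. pose proof (Rabs_pos_lt x Hx).
  rewrite exp_plus. replace (2 * ln (Rabs x)) with (ln (Rabs x) + ln (Rabs x)) by ring.
  rewrite exp_plus, exp_ln by assumption.
  rewrite <- (pow2_abs x). ring.
Qed.

(** The ends of the axis are N(oo) = m11 / m21, close to infinity, and N(0) = m12 / m22, close to a;
    over the box such a geodesic stays within O(eta) of the vertical line above a. *)
Lemma axis_near_vertical W : 1 <= W -> exists K, 1 <= K /\ forall N eta a z,
  mat_det N = 1 -> 0 < eta -> eta * (2 * (W + 1)) <= 1 -> Rabs a <= W ->
  Rabs (m21 N) <= eta * Rabs (m11 N) ->
  Rabs (m12 N - a * m22 N) < eta * Rabs (m22 N) ->
  in_box W z -> Rabs (Re z - a) <= eta ->
  exists t, sep z (axis N t) <= (K * eta) ^ 2.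
Proof.
  intros HW. set (K1 := 2 + W ^ 3 + W ^ 2). set (K2 := W ^ 3 + W * (W + 1)).
  assert (HW2 : 1 <= W ^ 2) by nra. assert (HW3 : 1 <= W ^ 3) by (simpl; nra).
  assert (HK1 : 1 <= K1) by (unfold K1; lra). assert (HK2 : 1 <= K2) by (unfold K2; nra).
  exists (2 * W * (K1 + K2)). split; [nra|].
  intros N eta a z HN Heta HetaW Ha H21 H12 Hz Hza.
  destruct Hz as [Hx [Hy1 Hy2]].
  set (x0 := Re z) in *. set (y0 := Im z) in *.
  assert (HiW : 0 < / W) by (apply Rinv_0_lt_compat; lra).
  assert (Hy0 : 0 < y0) by lra.
  unfold mat_det in HN.
  destruct N as [n11 n12 n21 n22]; cbn [m11 m12 m21 m22] in *.
  assert (Hn22 : n22 <> 0).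
  { intros E. rewrite E in H12. rewrite Rabs_R0 in H12. pose proof (Rabs_pos (n12 - a * 0)). lra. }
  assert (Hn11 : n11 <> 0).
  { intros E. rewrite E, Rabs_R0, Rmult_0_r in H21. pose proof (Rabs_pos n21).
    assert (E2 : n21 = 0) by (apply NNPP; intros E'; pose proof (Rabs_pos_lt _ E'); lra).
    rewrite E, E2 in HN. lra. }
  pose proof (Rabs_pos_lt _ Hn22) as Hn22'. pose proof (Rabs_pos_lt _ Hn11) as Hn11'.
  set (d := n21 / n11). set (b := n12 / n22).
  assert (Hd : Rabs d <= eta).
  { unfold d, Rdiv. rewrite Rabs_mult, Rabs_inv. now apply Rle_div_l. }
  assert (Hba : Rabs (b - a) <= eta).
  { replace (b - a) with ((n12 - a * n22) / n22) by (unfold b; field; assumption).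
    unfold Rdiv. rewrite Rabs_mult, Rabs_inv. apply Rle_div_l; lra. }
  assert (Heta1 : eta <= 1) by nra.
  assert (Hb : Rabs b <= W + 1).
  { replace b with (b - a + a) by ring. eapply Rle_trans; [apply Rabs_triang|]. lra. }
  pose proof (Rabs_mul_le _ _ _ _ Hd Hb) as Hdb.
  assert (Hdb' : Rabs (d * b) <= / 2) by lra.
  apply Rabs_le_between in Hdb'.
  assert (Hprod : n11 * n22 * (1 - d * b) = 1)
    by (rewrite <- HN at 2; unfold d, b; field; tauto).
  assert (Hpos : 0 < n11 * n22) by nra.
  set (D := 1 + d ^ 2 * y0 ^ 2).
  assert (HD : 1 <= D) by (unfold D; pose proof (pow2_ge_0 d); pose proof (pow2_ge_0 y0); nra).
  assert (HT : 0 < y0 * n22 / n11).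
  { replace (y0 * n22 / n11) with (y0 * (n11 * n22) * (/ n11) ^ 2) by (field; assumption).
    apply Rmult_lt_0_compat; [now apply Rmult_lt_0_compat|].
    now apply pow2_gt_0, Rinv_neq_0_compat. }
  (* At this parameter the axis passes through (b + i y0) / (1 + i d y0), a perturbation of b + i y0
     as d is small. *)
  exists (ln (y0 * n22 / n11)). unfold axis. rewrite exp_ln by exact HT.
  assert (DN : mat_det (Mat2 n11 n12 n21 n22) = 1) by exact HN.
  rewrite sep_coord, mobius_Re, mobius_Im by (try apply in_H_vertical; assumption).
  unfold auto_factor. simpl Re. simpl Im. cbn [m11 m12 m21 m22]. fold x0 y0.
  assert (Eq : (n21 * 0 + n22) ^ 2 + (n21 * (y0 * n22 / n11)) ^ 2 = n22 ^ 2 * D)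
    by (unfold D, d; field; assumption).
  assert (Ere : ((n11 * 0 + n12) * (n21 * 0 + n22) + n11 * n21 * (y0 * n22 / n11) ^ 2) / (n22 ^ 2 * D)
     = (b + d * y0 ^ 2) / D) by (unfold b, d; field; repeat split; try assumption; lra).
  assert (Eim : y0 * n22 / n11 / (n22 ^ 2 * D) = y0 * (1 - d * b) / D).
  { transitivity (y0 * (n11 * n22 * (1 - d * b)) / (n11 * n22 * D)).
    - rewrite Hprod. field. repeat split; try assumption; lra.
    - field. repeat split; try assumption; lra. }
  rewrite Eq, Ere, Eim.
  (* D times the differences of the real and of the imaginary parts. *)
  set (u1 := x0 * D - b - d * y0 ^ 2). set (u2 := y0 * (d ^ 2 * y0 ^ 2 + d * b)).
  transitivity ((u1 ^ 2 + u2 ^ 2) * / (D * y0 ^ 2 * (1 - d * b))).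
  { right. replace u2 with (y0 * (D - 1 + d * b)) by (unfold u2, D; ring).
    unfold u1. field. repeat split; lra. }
  assert (Hyy : Rabs y0 <= W) by (rewrite Rabs_pos_eq; lra).
  assert (Hy2W : Rabs (y0 ^ 2) <= W ^ 2).
  { simpl. rewrite !Rmult_1_r. now apply Rabs_mul_le. }
  assert (Hdy : Rabs (d * y0 ^ 2) <= eta * W ^ 2) by now apply Rabs_mul_le.
  assert (Hddy : Rabs (d * (d * y0 ^ 2)) <= eta * W ^ 2).
  { eapply Rle_trans; [apply (Rabs_mul_le _ _ _ _ Hd Hdy)|].
    assert (0 <= eta * W ^ 2) by nra. nra. }
  assert (Hu1 : Rabs u1 <= K1 * eta).
  { replace u1 with (((x0 - a) + - (b - a)) + (x0 * (d * (d * y0 ^ 2)) + - (d * y0 ^ 2)))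
      by (unfold u1, D; ring).
    assert (Hba' : Rabs (- (b - a)) <= eta) by now rewrite Rabs_Ropp.
    assert (Hdy' : Rabs (- (d * y0 ^ 2)) <= eta * W ^ 2) by now rewrite Rabs_Ropp.
    eapply Rle_trans; [apply (Rabs_add_le _ _ _ _ (Rabs_add_le _ _ _ _ Hza Hba')
      (Rabs_add_le _ _ _ _ (Rabs_mul_le _ _ _ _ Hx Hddy) Hdy'))|].
    unfold K1. simpl. lra. }
  assert (Hu2 : Rabs u2 <= K2 * eta).
  { unfold u2. replace (d ^ 2 * y0 ^ 2 + d * b) with (d * (d * y0 ^ 2) + d * b) by ring.
    eapply Rle_trans; [apply (Rabs_mul_le _ _ _ _ Hyy (Rabs_add_le _ _ _ _ Hddy Hdb))|].
    unfold K2. simpl. lra. }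
  assert (Hu : u1 ^ 2 + u2 ^ 2 <= ((K1 + K2) * eta) ^ 2).
  { rewrite <- (pow2_abs u1), <- (pow2_abs u2).
    assert (Rabs u1 ^ 2 <= (K1 * eta) ^ 2) by (apply pow_incr; split; [apply Rabs_pos|assumption]).
    assert (Rabs u2 ^ 2 <= (K2 * eta) ^ 2) by (apply pow_incr; split; [apply Rabs_pos|assumption]).
    assert (0 <= K1 * eta * (K2 * eta)) by (repeat apply Rmult_le_pos; lra). nra. }
  assert (Hden : / (2 * W ^ 2) <= D * y0 ^ 2 * (1 - d * b)).
  { assert (Hyi : (/ W) ^ 2 <= y0 ^ 2) by (apply pow_incr; lra).
    rewrite pow_inv in Hyi. rewrite Rinv_mult.
    assert (0 < / W ^ 2) by (apply Rinv_0_lt_compat; lra).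
    assert (/ W ^ 2 <= D * y0 ^ 2) by nra. nra. }
  apply Rle_trans with (((K1 + K2) * eta) ^ 2 * (2 * W ^ 2)).
  - apply Rmult_le_compat; [nra| |exact Hu|].
    + left; apply Rinv_0_lt_compat. eapply Rlt_le_trans; [|exact Hden]. apply Rinv_0_lt_compat; lra.
    + rewrite <- (Rinv_inv (2 * W ^ 2)). apply Rinv_le_contravar; [apply Rinv_0_lt_compat; lra|exact Hden].
  - pose proof (pow2_ge_0 (W * (K1 + K2) * eta)). nra.
Qed.

Lemma mat_mul_column1 P N x : mat_mul P N = mat_mul N (mat_diag x) ->
  mat_vec P (m11 N, m21 N) = (x * m11 N, x * m21 N).
Proof.
  intros E. pose proof (f_equal m11 E) as E1. pose proof (f_equal m21 E) as E2.
  simpl in E1, E2. unfold mat_vec; simpl. f_equal; lra.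
Qed.

Lemma mat_mul_column2 P N x : mat_mul P N = mat_mul N (mat_diag x) ->
  mat_vec P (m12 N, m22 N) = (/ x * m12 N, / x * m22 N).
Proof.
  intros E. pose proof (f_equal m12 E) as E1. pose proof (f_equal m22 E) as E2.
  simpl in E1, E2. unfold mat_vec; simpl. f_equal; lra.
Qed.

Lemma grid_near W eta : 1 <= W -> 0 < eta -> exists n h, INR n <= 2 * W / eta + 1 /\
  (forall j, In j (seq 0 (S n)) -> Rabs (- W + h * INR j) <= W) /\
  (forall x, Rabs x <= W -> exists j, In j (seq 0 (S n)) /\ Rabs (x - (- W + h * INR j)) <= eta).
Proof.
  intros HW Heta. set (q := 2 * W / eta).
  assert (Hq : 0 < q) by (apply Rdiv_lt_0_compat; lra).
  destruct (cell_bounds q) as [B1 B2]; [lra|].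
  set (n := S (cell q)). assert (Hn : INR n = INR (cell q) + 1) by apply S_INR.
  set (h := 2 * W / INR n).
  assert (Hh : 0 < h) by (apply Rdiv_lt_0_compat; lra).
  assert (Hhn : h * INR n = 2 * W) by (unfold h; field; lra).
  assert (Hheta : h <= eta).
  { unfold h. apply Rle_div_l; [lra|].
    replace (2 * W) with (eta * q) by (unfold q; field; lra). apply Rmult_le_compat_l; lra. }
  exists n, h. split; [lra|split].
  - intros j Hj. apply in_seq in Hj. assert (Hjn : INR j <= INR n) by (apply le_INR; lia).
    pose proof (pos_INR j). apply Rabs_le_between. nra.
  - intros x Hx. apply Rabs_le_between in Hx.
    assert (H0 : 0 <= (x + W) / h) by (apply Rdiv_le_0_compat; lra).
    destruct (cell_bounds _ H0) as [C1 C2].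
    exists (cell ((x + W) / h)).
    assert (Ex : x + W = h * ((x + W) / h)) by (field; lra).
    split.
    + apply cell_in_seq. split; [exact H0|]. rewrite S_INR.
      assert ((x + W) / h <= INR n); [|lra]. apply Rle_div_l; lra.
    + apply Rabs_le_between. nra.
Qed.

(** * An element of the group with dense axis *)

Section DenseAxis.
Context (G : mat2 -> Prop) (HG : subgroup_PSL G) (HD : discrete G)
  (HF : acts_freely G) (HC : compact_quotient G).

Lemma mat_prod_in_G l : (forall g, In g l -> G g) -> G (mat_prod l).
Proof.
  induction l as [|g l IH]; intros Hl; simpl; [apply (G_one G HG)|].
  apply (G_mul G HG); [apply Hl; now left|]. apply IH. intros; apply Hl; now right.
Qed.

Lemma pushers_axis eta W l : 0 < eta -> 1 <= W -> eta * (2 * (W + 1)) <= 1 -> l <> [] ->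
  (forall g, In g l -> G g /\ exists a, Rabs a <= W /\ pusher eta W a g) ->
  exists N x, mat_det N = 1 /\ 1 < Rabs x <= mat_norm (mat_prod l) /\
    mat_mul (mat_prod l) N = mat_mul N (mat_diag x).
Proof.
  intros Heta HW HetaW Hne Hl. set (P := mat_prod l).
  assert (HP : G P) by (apply mat_prod_in_G; intros g Hg; now apply Hl).
  pose proof (G_det G HG P HP) as DP.
  (* The boundary point W + 1 is neither within eta of some |a| <= W nor beyond 1 / eta, the only
     places for fixed points of P. Hence P is nontrivial, and this vector can feed
     [hyperbolic_diagonalization]. *)
  assert (Hw : wedge (W + 1, 1) (mat_vec P (W + 1, 1)) <> 0).
  { destruct (exists_last Hne) as (l' & g & El).
    destruct (Hl g) as (_ & a & Ha & Hg); [rewrite El; apply in_elt|].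
    intros E.
    assert (EP : P = mat_mul (mat_prod l') g).
    { unfold P. rewrite El, mat_prod_app. simpl. now rewrite mat_mul_1_r. }
    destruct (pushers_eigenvector eta W Heta HW HetaW l' a g (W + 1, 1) (snd (mat_vec P (W + 1, 1))))
      as [[H1 _]|[H1 _]]; auto.
    - intros h Hh. apply Hl. rewrite El. apply in_or_app; now left.
    - now rewrite <- EP.
    - intros E'. injection E'; lra.
    - rewrite <- EP. unfold wedge in E. cbn [fst snd] in E |- *.
      apply vec_eq; cbn [fst snd]; lra.
    - cbn [fst snd] in H1. apply Rabs_le_between in Ha. rewrite Rabs_R1 in H1.
      rewrite Rabs_pos_eq in H1; nra.
    - cbn [fst snd] in H1. rewrite Rabs_R1, Rabs_pos_eq in H1; nra. }
  assert (HP1 : ~ eq_PSL P mat_one).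
  { intros [E|E]; apply Hw; rewrite E; unfold wedge, mat_vec; simpl; ring. }
  pose proof (hyperbolic_of_nontrivial G HG HD HF HC P HP HP1) as Htr.
  destruct (hyperbolic_diagonalization P _ DP Htr Hw) as (N & x & DN & Hx & E).
  exists N, x. repeat split; auto; [tauto|].
  apply Rle_trans with (Rabs (mat_tr P)); [tauto|].
  unfold mat_tr, mat_norm. eapply Rle_trans; [apply Rabs_triang|].
  pose proof (Rabs_pos (m12 P)); pose proof (Rabs_pos (m21 P)); lra.
Qed.

(* Conjugating the product to its cyclic rotation ending in [g] puts the ends of the axis near
   [a] and near infinity. *)
Lemma pushers_axis_directions eta W l N x g a : 0 < eta -> 1 <= W -> eta * (2 * (W + 1)) <= 1 ->
  (forall h, In h l -> G h /\ exists a, Rabs a <= W /\ pusher eta W a h) ->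
  mat_det N = 1 -> 1 < Rabs x -> mat_mul (mat_prod l) N = mat_mul N (mat_diag x) ->
  In g l -> Rabs a <= W -> pusher eta W a g ->
  exists H, G H /\ let N' := mat_mul H N in
    Rabs (m21 N') <= eta * Rabs (m11 N') /\
    Rabs (m12 N' - a * m22 N') < eta * Rabs (m22 N').
Proof.
  intros Heta HW HetaW Hl DN Hx EP Hgl Ha Hg.
  destruct (in_split _ _ Hgl) as (l1 & l2 & El).
  assert (HlG : forall m, incl m l -> G (mat_prod m)).
  { intros m Hm. apply mat_prod_in_G. intros h Hh. now apply Hl, Hm. }
  assert (Hl1 : incl l1 l) by (rewrite El; apply incl_appl, incl_refl).
  assert (Hl2 : incl l2 l) by (rewrite El; apply incl_appr, incl_tl, incl_refl).
  assert (HgG : G g) by now apply Hl.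
  set (H := mat_mul (mat_prod l1) g).
  assert (HH : G H) by (apply (G_mul G HG); auto).
  pose proof (G_det G HG H HH) as DH.
  assert (E1 : mat_prod l = mat_mul H (mat_prod l2)).
  { rewrite El, mat_prod_app. simpl. apply mat_mul_assoc. }
  set (Q := mat_mul (mat_prod (l2 ++ l1)) g).
  assert (E2 : Q = mat_mul (mat_prod l2) H).
  { unfold Q, H. rewrite mat_prod_app. now rewrite mat_mul_assoc. }
  assert (DQ : mat_det Q = 1).
  { rewrite E2. apply (G_det G HG), (G_mul G HG); auto. }
  set (N' := mat_mul (mat_inv H) N).
  assert (DN' : mat_det N' = 1) by (unfold N'; rewrite mat_det_mul, mat_det_inv, DH, DN; ring).
  assert (EQ : mat_mul Q N' = mat_mul N' (mat_diag x)).
  { unfold N'. rewrite E2, <- !mat_mul_assoc, mat_mul_inv_l by assumption.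
    rewrite <- EP, E1, <- mat_mul_assoc, mat_inv_mul_l; auto. }
  exists (mat_inv H). split; [now apply (G_inv G HG)|]. fold N'. cbv zeta. clearbody N'.
  assert (Hl' : forall h, In h (l2 ++ l1) -> exists a, Rabs a <= W /\ pusher eta W a h).
  { intros h Hh. apply Hl. apply in_app_or in Hh as [Hh|Hh]; auto. }
  unfold mat_det in DN'.
  split.
  (* The columns of N' are eigenvectors of the rotated product Q for x and / x; as |x| > 1, the
     first is the one near infinity and the second the one near a. *)
  - destruct (pushers_eigenvector eta W Heta HW HetaW (l2 ++ l1) a g (m11 N', m21 N') x)
      as [[_ Hc]|[H1 _]]; auto using mat_mul_column1; [|lra].
    intros E; injection E as Ea Eb. rewrite Ea, Eb in DN'. lra.
  - destruct (pushers_eigenvector eta W Heta HW HetaW (l2 ++ l1) a g (m12 N', m22 N') (/ x))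
      as [[H1 _]|[_ Hc]]; auto using mat_mul_column2.
    + intros E; injection E as Ea Eb. rewrite Ea, Eb in DN'. lra.
    + exfalso. rewrite Rabs_inv in Hc. rewrite <- Rinv_1 in Hc.
      apply Rinv_lt_contravar in Hx; lra.
Qed.

Lemma dense_axis : exists C1, 0 < C1 /\ forall eps, 0 < eps <= 1 / 2 ->
  exists N P x, mat_det N = 1 /\ G P /\ 1 < Rabs x /\ mat_mul P N = mat_mul N (mat_diag x) /\
    2 * ln (Rabs x) <= C1 * (1 / eps) * ln (1 / eps) /\
    forall z, in_H z -> exists A t, G A /\ sep z (mobius A (axis N t)) <= eps ^ 2.
Proof.
  destruct (cocompact_box G HG HC) as (W & HW & Hbox).
  destruct (pushers_exist G HG HD HF HC W HW) as (K & HK & Hpush).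
  destruct (axis_near_vertical W HW) as (Kd & HKd & Hnear).
  (* With eta = eps / kap, both the smallness condition eta * (2 * (W + 1)) <= 1 and the final error
     Kd * eta <= eps hold. *)
  set (kap := Kd + (W + 1)).
  (* Since ln (1 / eps) >= ln 2, this constant absorbs ln (K * kap): ln (K / eta) <= c2 * ln (1 /
     eps). *)
  set (c2 := ln (K * kap) / ln 2 + 1).
  assert (Hln2 : 0 < ln 2) by (rewrite <- ln_1; apply ln_increasing; lra).
  assert (HKk : 1 <= K * kap) by (unfold kap; nra).
  assert (HlnK : 0 <= ln (K * kap)) by (rewrite <- ln_1; apply ln_le; lra).
  assert (Hc2 : 1 <= c2).
  { unfold c2. assert (0 <= ln (K * kap) / ln 2); [apply Rdiv_le_0_compat; lra|lra]. }
  exists (2 * (1 + (2 * W * kap + 1) * c2)).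
  assert (Hkap : 1 < kap) by (unfold kap; lra).
  assert (HWk : 0 < 2 * W * kap + 1) by nra.
  split; [nra|]. intros eps Heps.
  set (eta := eps / kap).
  assert (Heta : 0 < eta) by (apply Rdiv_lt_0_compat; lra).
  assert (Eeta : eta * kap = eps) by (unfold eta; field; lra).
  assert (HetaW : eta * (2 * (W + 1)) <= 1) by (unfold kap in Eeta; nra).
  assert (HKeta : Kd * eta <= eps) by (unfold kap in Eeta; nra).
  assert (Hg : forall a, exists g, Rabs a <= W -> G g /\ pusher eta W a g /\ mat_norm g <= K / eta).
  { intros a. destruct (Rle_lt_dec (Rabs a) W) as [L|L].
    - destruct (Hpush eta a Heta HetaW L) as (g & Hg). exists g. now intros _.
    - exists mat_one. intros; exfalso; lra. }
  apply functional_choice in Hg as [f Hf].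
  destruct (grid_near W eta HW Heta) as (n & h & Hn & Hgrid & Hdense).
  set (pt := fun j => - W + h * INR j).
  set (l := map (fun j => f (pt j)) (seq 0 (S n))).
  assert (Hl : forall g, In g l -> exists a, Rabs a <= W /\ g = f a).
  { intros g Hgl. apply in_map_iff in Hgl as (j & <- & Hj). exists (pt j).
    split; [now apply Hgrid|reflexivity]. }
  assert (Hl' : forall g, In g l -> G g /\ exists a, Rabs a <= W /\ pusher eta W a g).
  { intros g Hgl. destruct (Hl g Hgl) as (a & Ha & ->). destruct (Hf a Ha) as (H1 & H2 & _).
    split; [assumption|]. now exists a. }
  destruct (pushers_axis eta W l Heta HW HetaW) as (N & x & DN & [Hx1 Hx2] & EP);
    [discriminate|exact Hl'|].
  exists N, (mat_prod l), x.
  split; [exact DN|]. split; [apply mat_prod_in_G; intros g Hgl; now apply Hl'|].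
  split; [exact Hx1|]. split; [exact EP|]. split.
  - assert (HKe0 : K / eta = K * kap * (1 / eps)) by (rewrite <- Eeta; field; lra).
    assert (Hie : 2 <= 1 / eps) by (apply Rle_div_r; lra).
    assert (HKe : 1 <= K / eta) by (rewrite HKe0; nra).
    set (lam := ln (1 / eps)).
    assert (Hlam : ln 2 <= lam) by (apply ln_le; lra).
    assert (Hln : ln (K / eta) <= c2 * lam).
    { rewrite HKe0, ln_mult by lra. fold lam. unfold c2.
      assert (ln (K * kap) <= ln (K * kap) / ln 2 * lam); [|lra].
      replace (ln (K * kap)) with (ln (K * kap) / ln 2 * ln 2) at 1 by (field; lra).
      apply Rmult_le_compat_l; [|lra]. apply Rdiv_le_0_compat; lra. }
    assert (Hpow : 0 < (K / eta) ^ (S n)) by (apply pow_lt; lra).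
    assert (Hlnx : ln (Rabs x) <= ln 2 + INR (S n) * ln (K / eta)).
    { rewrite <- ln_pow, <- ln_mult by lra. apply ln_le; [lra|].
      eapply Rle_trans; [exact Hx2|].
      replace (S n) with (length l) by (unfold l; now rewrite length_map, length_seq).
      apply mat_prod_norm; [lra|]. intros g Hgl.
      destruct (Hl g Hgl) as (a & Ha & ->). now apply Hf. }
    assert (Hn1 : INR (S n) <= (2 * W * kap + 1) * (1 / eps)).
    { rewrite S_INR. replace (2 * W / eta) with (2 * W * kap * (1 / eps)) in Hn
        by (rewrite <- Eeta; field; lra). lra. }
    assert (0 <= ln (K / eta)) by (rewrite <- ln_1; apply ln_le; lra).
    assert (INR (S n) * ln (K / eta) <= (2 * W * kap + 1) * (1 / eps) * (c2 * lam)).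
    { apply Rmult_le_compat; try assumption. apply pos_INR. }
    assert (ln 2 <= 1 / eps * lam) by nra. lra.
  - intros z Hz. destruct (Hbox z Hz) as (A0 & HA0 & HzW).
    set (z0 := mobius A0 z) in *.
    destruct (Hdense (Re z0)) as (j & Hj & Hjz); [apply HzW|]. fold (pt j) in Hjz.
    assert (Ha : Rabs (pt j) <= W) by now apply Hgrid.
    destruct (Hf (pt j) Ha) as (Hg1 & Hg2 & _).
    destruct (pushers_axis_directions eta W l N x (f (pt j)) (pt j)) as (H & HH & D1 & D2); auto.
    { apply in_map_iff. now exists j. }
    pose proof (G_det G HG H HH) as DH. pose proof (G_det G HG A0 HA0) as DA0.
    assert (DHN : mat_det (mat_mul H N) = 1) by (rewrite mat_det_mul, DH, DN; ring).
    destruct (Hnear (mat_mul H N) eta (pt j) z0 DHN Heta HetaW Ha D1 D2 HzW Hjz) as (t & Ht).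
    assert (HAH : G (mat_mul (mat_inv A0) H)) by (apply (G_mul G HG); [now apply (G_inv G HG)|assumption]).
    exists (mat_mul (mat_inv A0) H), t. split; [assumption|].
    rewrite <- mobius_axis in Ht by assumption.
    rewrite mobius_mul by (rewrite ?mat_det_inv; auto using axis_in_H).
    assert (Hw : in_H (mobius H (axis N t))) by auto using mobius_in_H, axis_in_H.
    rewrite <- (sep_mobius A0), mobius_inv_r by
      (rewrite ?mat_det_inv; auto using mobius_in_H; apply mobius_in_H; rewrite ?mat_det_inv; auto).
    fold z0. eapply Rle_trans; [exact Ht|]. apply pow_incr. nra.
Qed.

End DenseAxis.

(** * Self-intersections *)

(** Translation by l along the axis as a matrix identity; the half appears because [mat_diag x]
    translates the vertical line by 2 ln |x|. *)
Definition axis_period (G : mat2 -> Prop) (N : mat2) (l : R) : Prop :=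
  exists A, G A /\ mat_mul A N = mat_mul N (mat_diag (exp (l / 2))).

Lemma mat_mul_opp_l A B : mat_mul (mat_opp A) B = mat_opp (mat_mul A B).
Proof. mat_solve. Qed.

Lemma mobius_eq_of_eq_PSL A B z : mat_det A = 1 -> mat_det B = 1 -> in_H z ->
  eq_PSL (mat_mul B (mat_inv A)) mat_one -> mobius B z = mobius A z.
Proof.
  intros DA DB Hz E.
  assert (EB : B = mat_mul (mat_mul B (mat_inv A)) A).
  { rewrite <- mat_mul_assoc, mat_inv_l by assumption. now rewrite mat_mul_1_r. }
  destruct E as [E|E]; rewrite EB, E.
  - now rewrite mat_mul_1_l.
  - rewrite mat_mul_opp_l, mat_mul_1_l. now apply mobius_opp.
Qed.

Lemma sinh_sqr_le x y : Rabs x <= y -> (2 * sinh x) ^ 2 <= (2 * sinh y) ^ 2.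
Proof.
  intros H. apply pow_maj_Rabs. apply Rabs_le_between in H.
  pose proof (sinh_le x y). pose proof (sinh_le (- y) x).
  assert (Hodd : sinh (- y) = - sinh y) by (unfold sinh; rewrite Ropp_involutive; field).
  rewrite Hodd in *. apply Rabs_le_between. lra.
Qed.

Lemma stabilizer_of_i R0 : mat_det R0 = 1 -> mobius R0 (0, 1) = (0, 1) ->
  m22 R0 = m11 R0 /\ m12 R0 = - m21 R0.
Proof.
  intros HD E. pose proof (in_H_vertical 1 Rlt_0_1) as Hi.
  pose proof (auto_factor_pos R0 _ HD Hi) as Hq.
  pose proof (f_equal Re E) as ER. pose proof (f_equal Im E) as EI.
  rewrite mobius_Re in ER by assumption. rewrite mobius_Im in EI by assumption.
  unfold auto_factor, mat_det in *. destruct R0 as [a b c d].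
  cbn [m11 m12 m21 m22] in *. simpl Re in *. simpl Im in *.
  assert (EI' : (c * 0 + d) ^ 2 + (c * 1) ^ 2 = 1).
  { apply (Rmult_eq_compat_r ((c * 0 + d) ^ 2 + (c * 1) ^ 2)) in EI.
    unfold Rdiv in EI. rewrite Rmult_assoc, Rinv_l in EI by lra. lra. }
  assert (ER' : (a * 0 + b) * (c * 0 + d) + a * c * 1 ^ 2 = 0).
  { rewrite EI' in ER. unfold Rdiv in ER. rewrite Rinv_1 in ER. lra. }
  assert (Ecd : d * d + c * c = 1) by lra.
  assert (Ebd : b * d + a * c = 0) by lra.
  split.
  - transitivity (d * (a * d - b * c)); [rewrite HD; ring|].
    transitivity (a * (d * d + c * c) - c * (b * d + a * c)); [ring|].
    rewrite Ecd, Ebd. ring.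
  - transitivity (b * (d * d + c * c)); [rewrite Ecd; ring|].
    transitivity (d * (b * d + a * c) - c * (a * d - b * c)); [ring|].
    rewrite HD, Ebd. ring.
Qed.

(** The hyperbolic law of cosines at i. The weights are cos^2 and sin^2 of half the rotation angle,
    so [sep] lies between its values for aligned and for opposite directions. *)
Lemma sep_rotation R0 u v : mat_det R0 = 1 -> mobius R0 (0, 1) = (0, 1) ->
  sep (0, exp v) (mobius R0 (0, exp u)) =
  m11 R0 ^ 2 * (2 * sinh ((v - u) / 2)) ^ 2 + m21 R0 ^ 2 * (2 * sinh ((v + u) / 2)) ^ 2.
Proof.
  intros HD E. destruct (stabilizer_of_i R0 HD E) as [E1 E2].
  pose proof (in_H_vertical _ (exp_pos u)) as Hu.
  pose proof (auto_factor_pos R0 _ HD Hu) as Hq.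
  assert (Hsq : forall x, (2 * sinh (x / 2)) ^ 2 = exp x + / exp x - 2).
  { intros x. replace x with (x / 2 + x / 2) at 2 3 by field.
    unfold sinh. rewrite exp_Ropp, exp_plus. pose proof (exp_pos (x / 2)). field. lra. }
  rewrite !Hsq. replace (v - u) with (v + - u) by ring. rewrite !exp_plus, exp_Ropp.
  rewrite sep_coord, mobius_Re, mobius_Im by assumption.
  unfold auto_factor, mat_det in *. rewrite E1, E2 in *. simpl Re in *. simpl Im in *.
  pose proof (exp_pos u). pose proof (exp_pos v).
  set (y := exp u) in *. set (Y := exp v) in *.
  set (p := m11 R0) in *. set (q := m21 R0) in *.
  assert (Hp : p ^ 2 = 1 - q ^ 2) by lra.
  set (D := p ^ 2 + q ^ 2 * y ^ 2).
  assert (ED : (q * 0 + p) ^ 2 + (q * y) ^ 2 = D) by (unfold D; ring).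
  rewrite ED in *.
  transitivity ((p ^ 2 * q ^ 2 * (y ^ 2 - 1) ^ 2 + (Y * D - y) ^ 2) / (D * Y * y)).
  { field. repeat split; lra. }
  assert (ED' : D = 1 + q ^ 2 * (y ^ 2 - 1)) by (unfold D; rewrite Hp; ring).
  rewrite Hp.
  replace ((1 - q ^ 2) * q ^ 2 * (y ^ 2 - 1) ^ 2) with
    ((D - 1) * (y ^ 2 - D)) by (rewrite ED'; ring).
  transitivity (((D * Y ^ 2 + (1 + y ^ 2 - D)) / (Y * y) - 2)); [field; repeat split; lra|].
  rewrite ED'. field. split; lra.
Qed.

Section Counting.
Context (G : mat2 -> Prop) (HG : subgroup_PSL G) (HD : discrete G)
  (HF : acts_freely G) (HC : compact_quotient G).
Context (r : R) (Hr : 0 < r)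
  (Hinj : forall A z, G A -> in_H z -> sep z (mobius A z) <= (2 * sinh r) ^ 2 -> eq_PSL A mat_one).
Context (N : mat2) (DN : mat_det N = 1).

Lemma axis_period_of_diag A x : G A -> x <> 0 -> mat_mul A N = mat_mul N (mat_diag x) ->
  axis_period G N (2 * ln (Rabs x)).
Proof.
  intros HA Hx E. unfold axis_period.
  replace (2 * ln (Rabs x) / 2) with (ln (Rabs x)) by field.
  rewrite exp_ln by now apply Rabs_pos_lt.
  destruct (Rle_lt_dec 0 x) as [L|L].
  - exists A. rewrite Rabs_pos_eq by assumption. now split.
  - exists (mat_opp A). split; [now apply (G_opp G HG)|].
    rewrite mat_mul_opp_l, E, Rabs_left by assumption. mat_solve.
    + field. exact Hx.
    + field. exact Hx.
Qed.

Lemma axis_period_mobius l : axis_period G N l ->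
  exists A, G A /\ forall t, mobius A (axis N t) = axis N (t + l).
Proof.
  intros (A & HA & E). exists A. split; [exact HA|]. intros t.
  pose proof (exp_pos (l / 2)).
  rewrite (axis_translate A N (exp (l / 2))) by (auto; try lra; now apply (G_det G HG)).
  f_equal. rewrite Rabs_pos_eq, ln_exp by lra. field.
Qed.

Lemma axis_period_sub l l' : axis_period G N l -> axis_period G N l' -> axis_period G N (l - l').
Proof.
  intros (A & HA & E) (A' & HA' & E'). exists (mat_mul (mat_inv A') A).
  split; [apply (G_mul G HG); [now apply (G_inv G HG)|assumption]|].
  pose proof (G_det G HG A' HA') as DA'.
  assert (Ed : mat_diag (exp (l / 2)) = mat_mul (mat_diag (exp (l' / 2))) (mat_diag (exp ((l - l') / 2)))).
  { replace (l / 2) with (l' / 2 + (l - l') / 2) by field. rewrite exp_plus.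
    pose proof (exp_pos (l' / 2)). pose proof (exp_pos ((l - l') / 2)).
    mat_solve. field. lra. }
  rewrite <- mat_mul_assoc, E, Ed, (mat_mul_assoc N), <- E', <- mat_mul_assoc.
  now rewrite mat_inv_mul_l.
Qed.

Lemma axis_period_lower l : 0 < l -> axis_period G N l -> 2 * r <= l.
Proof.
  intros Hl Hp. apply Rnot_lt_le; intros L.
  destruct (axis_period_mobius l Hp) as (A & HA & HAt).
  assert (E : eq_PSL A mat_one).
  { apply Hinj with (axis N 0); auto using axis_in_H. rewrite HAt. unfold axis.
    rewrite sep_mobius by (auto; apply in_H_vertical, exp_pos). rewrite sep_vertical.
    apply sinh_sqr_le. apply Rabs_le_between. lra. }
  assert (E' : mobius A (axis N 0) = axis N 0).
  { pose proof (axis_in_H N 0 DN). destruct E as [->| ->].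
    - apply mobius_one.
    - rewrite mobius_opp, mobius_one; auto. unfold mat_det; simpl; ring. }
  pose proof (axis_unit_speed N (0 + l) 0 DN) as Hd.
  rewrite <- HAt, E', axis_unit_speed in Hd by assumption.
  rewrite Rminus_diag, Rabs_R0, Rabs_pos_eq in Hd; lra.
Qed.

(** Passing to a smaller period loses a difference of periods, itself a period and so at least 2 r;
    the descent ends within l0 / (2 r) steps. *)
Lemma minimal_axis_period l0 : 0 < l0 -> axis_period G N l0 ->
  exists l, 0 < l <= l0 /\ axis_period G N l /\ forall l', 0 < l' < l -> ~ axis_period G N l'.
Proof.
  intros H0 Hp0. destruct (INR_unbounded (l0 / (2 * r))) as [n Hn].
  assert (Hn' : l0 <= INR n * (2 * r)) by (apply Rle_div_l; lra).
  clear Hn. revert l0 H0 Hp0 Hn'. induction n as [|n IH]; intros l0 H0 Hp0 Hn.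
  - simpl in Hn. lra.
  - destruct (classic (exists l', 0 < l' < l0 /\ axis_period G N l')) as [(l' & Hl' & Hp')|Hno].
    + destruct (IH l') as (l & Hl & Hpl & Hmin); try tauto.
      * pose proof (axis_period_lower (l0 - l')) as HL.
        rewrite S_INR in Hn. specialize (HL ltac:(lra) (axis_period_sub _ _ Hp0 Hp')). lra.
      * exists l. repeat split; try tauto; lra.
    + exists l0. repeat split; try tauto; try lra. intros l' Hl' Hp'. apply Hno. now exists l'.
Qed.

(** A' A^-1 carries the point t of the axis to A' (axis N s), and A' (axis N s') is the point t'.
    Through the latter the displacement is at most |s - s'| + |t - t'| < 2 r; [sep_rotation]
    provides this bound. *)
Lemma axis_close_strands A A' s t s' t' : G A -> G A' ->
  mobius A (axis N s) = axis N t -> mobius A' (axis N s') = axis N t' ->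
  Rabs (s - s') < r -> Rabs (t - t') < r -> eq_PSL (mat_mul A' (mat_inv A)) mat_one.
Proof.
  intros HA HA' E E' Hs Ht.
  pose proof (G_det G HG A HA) as DA. pose proof (G_det G HG A' HA') as DA'.
  assert (DAi : mat_det (mat_inv A) = 1) by now rewrite mat_det_inv.
  assert (DNi : mat_det (mat_inv N) = 1) by now rewrite mat_det_inv.
  pose proof (axis_in_H N s DN). pose proof (axis_in_H N t DN). pose proof (axis_in_H N s' DN).
  apply Hinj with (axis N t); auto.
  { apply (G_mul G HG); [assumption|now apply (G_inv G HG)]. }
  rewrite mobius_mul, <- E, mobius_inv_l, E by auto.
  set (es := exp (s' / 2)). set (et := exp (t' / 2)).
  assert (Hes : es <> 0) by (pose proof (exp_pos (s' / 2)); unfold es; lra).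
  assert (Het : et <> 0) by (pose proof (exp_pos (t' / 2)); unfold et; lra).
  assert (Hsq : forall x, (exp (x / 2)) ^ 2 = exp x).
  { intros x. simpl. rewrite Rmult_1_r, <- exp_plus. f_equal. field. }
  assert (Hdg : forall x u, mobius (mat_diag (exp (x / 2))) (0, exp u) = (0, exp (u + x))).
  { intros x u. pose proof (exp_pos (x / 2)). rewrite mobius_diag by (try apply exp_pos; lra).
    rewrite Hsq, <- exp_plus. do 2 f_equal. ring. }
  set (Ds := mat_diag es). set (Dt := mat_diag et).
  assert (DDs : mat_det Ds = 1) by now apply mat_det_diag.
  assert (DDt : mat_det Dt = 1) by now apply mat_det_diag.
  set (NT := mat_mul N Dt).
  assert (DNT : mat_det NT = 1) by (unfold NT; rewrite mat_det_mul, DN, DDt; ring).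
  assert (DNTi : mat_det (mat_inv NT) = 1) by now rewrite mat_det_inv.
  (* A' read in frames based at the parameters s' and t' of the axis: it fixes i and turns the
     vertical line by the angle between the strands. *)
  set (R0 := mat_mul (mat_inv NT) (mat_mul A' (mat_mul N Ds))).
  assert (DND : mat_det (mat_mul N Ds) = 1) by (rewrite mat_det_mul, DN, DDs; ring).
  assert (DAND : mat_det (mat_mul A' (mat_mul N Ds)) = 1) by (rewrite mat_det_mul, DA', DND; ring).
  assert (DR : mat_det R0 = 1) by (unfold R0; rewrite mat_det_mul, DNTi, DAND; ring).
  assert (HNs : forall u, mobius (mat_mul N Ds) (0, exp u) = axis N (u + s')).
  { intros u. rewrite mobius_mul by (auto; apply in_H_vertical, exp_pos).
    unfold Ds, es. now rewrite Hdg. }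
  assert (HNt : forall u, mobius NT (0, exp u) = axis N (u + t')).
  { intros u. unfold NT. rewrite mobius_mul by (auto; apply in_H_vertical, exp_pos).
    unfold Dt, et. now rewrite Hdg. }
  assert (HR : forall u, mobius NT (mobius R0 (0, exp u)) = mobius A' (axis N (u + s'))).
  { intros u. pose proof (in_H_vertical _ (exp_pos u)) as Hu.
    rewrite <- HNs. unfold R0. rewrite mobius_mul by assumption.
    rewrite mobius_inv_r by (auto using mobius_in_H). now rewrite mobius_mul. }
  assert (HRi : mobius R0 (0, 1) = (0, 1)).
  { rewrite <- exp_0. pose proof (in_H_vertical _ (exp_pos 0)) as H00.
    rewrite <- (mobius_inv_l NT (mobius R0 (0, exp 0))) by auto using mobius_in_H.
    rewrite HR, Rplus_0_l, E', <- (Rplus_0_l t'), <- HNt. now apply mobius_inv_l. }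
  replace s with (s - s' + s') by ring. rewrite <- HR.
  replace t with (t - t' + t') by ring. rewrite <- HNt.
  pose proof (in_H_vertical _ (exp_pos (t - t'))). pose proof (in_H_vertical _ (exp_pos (s - s'))).
  rewrite sep_mobius, sep_rotation by auto using mobius_in_H.
  destruct (stabilizer_of_i R0 DR HRi) as [E1 E2].
  assert (Hpq : m11 R0 ^ 2 + m21 R0 ^ 2 = 1).
  { rewrite <- DR. unfold mat_det. rewrite E1, E2. ring. }
  apply Rabs_lt_between in Hs, Ht.
  pose proof (sinh_sqr_le ((t - t' - (s - s')) / 2) r) as B1.
  pose proof (sinh_sqr_le ((t - t' + (s - s')) / 2) r) as B2.
  rewrite Rabs_le_between in B1, B2.
  specialize (B1 ltac:(lra)). specialize (B2 ltac:(lra)).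
  pose proof (pow2_ge_0 (m11 R0)). pose proof (pow2_ge_0 (m21 R0)).
  apply (Rmult_le_compat_l (m11 R0 ^ 2)) in B1; [|assumption].
  apply (Rmult_le_compat_l (m21 R0 ^ 2)) in B2; [|assumption].
  replace ((2 * sinh r) ^ 2) with (m11 R0 ^ 2 * (2 * sinh r) ^ 2 + m21 R0 ^ 2 * (2 * sinh r) ^ 2)
    by (rewrite <- Rmult_plus_distr_r, Hpq; ring).
  lra.
Qed.

Lemma axis_param_inj s t : axis N s = axis N t -> s = t.
Proof.
  intros E. pose proof (axis_unit_speed N s t DN) as H.
  rewrite E, axis_unit_speed, Rminus_diag, Rabs_R0 in H by exact DN.
  apply NNPP; intros Hne. pose proof (Rabs_pos_lt (s - t)). lra.
Qed.

(* An element carrying two points of the axis into the axis preserves it; it cannot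
   reverse it, having then trace zero. *)
Lemma axis_two_points A s t s' t' : G A -> s <> s' ->
  mobius A (axis N s) = axis N t -> mobius A (axis N s') = axis N t' -> axis_period G N (t - s).
Proof.
  intros HA Hne E E'.
  pose proof (G_det G HG A HA) as DA.
  assert (DNi : mat_det (mat_inv N) = 1) by now rewrite mat_det_inv.
  set (B := mat_mul (mat_inv N) (mat_mul A N)).
  assert (DAN : mat_det (mat_mul A N) = 1) by (rewrite mat_det_mul, DA, DN; ring).
  assert (DB : mat_det B = 1) by (unfold B; rewrite mat_det_mul, DNi, DAN; ring).
  (* That B sends a point of the vertical line to the line is a linear equation in exp u ^ 2; two
     distinct parameters kill both coefficients, so B is diagonal or antidiagonal. *)
  assert (HB : forall u v, mobius A (axis N u) = axis N v ->
    m12 B * m22 B + m11 B * m21 B * exp u ^ 2 = 0).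
  { intros u v Huv. pose proof (in_H_vertical _ (exp_pos u)) as Hu.
    assert (EB : mobius B (0, exp u) = (0, exp v)).
    { unfold B. rewrite !mobius_mul by assumption. change (mobius N (0, exp u)) with (axis N u).
      rewrite Huv. apply mobius_inv_l; [assumption|]. apply in_H_vertical, exp_pos. }
    pose proof (auto_factor_pos B _ DB Hu) as Hq.
    apply (f_equal Re) in EB. rewrite mobius_Re in EB by assumption. simpl Re in EB. simpl Im in EB.
    apply (Rmult_eq_compat_r (auto_factor B (0, exp u))) in EB.
    unfold Rdiv in EB. rewrite Rmult_assoc, Rinv_l in EB by lra. lra. }
  pose proof (HB _ _ E) as H1. pose proof (HB _ _ E') as H2.
  assert (Hexp : exp s ^ 2 - exp s' ^ 2 <> 0).
  { pose proof (exp_pos s). pose proof (exp_pos s').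
    replace (exp s ^ 2 - exp s' ^ 2) with ((exp s - exp s') * (exp s + exp s')) by ring.
    apply Rmult_integral_contrapositive. split; [|lra].
    intros E0. apply Hne, exp_inv. lra. }
  assert (Hac : m11 B * m21 B = 0) by (apply Rmult_eq_reg_r with (exp s ^ 2 - exp s' ^ 2); [lra|assumption]).
  assert (Hbd : m12 B * m22 B = 0) by (rewrite Hac in H1; lra).
  assert (EAN : mat_mul A N = mat_mul N B) by (unfold B; now rewrite mat_mul_inv_l).
  assert (Htr : mat_tr B = mat_tr A).
  { replace (mat_tr A) with (mat_tr A * mat_det N) by (rewrite DN; ring).
    unfold mat_tr, B, mat_det; simpl. ring. }
  clearbody B. unfold mat_det in DB.
  apply Rmult_integral in Hac as [Ha|Hc].
  - exfalso. rewrite Ha in DB.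
    assert (Hb : m12 B <> 0) by (intros E0; rewrite E0 in DB; lra).
    assert (Hd : m22 B = 0) by (apply Rmult_integral in Hbd; tauto).
    assert (Htr0 : mat_tr A = 0) by (rewrite <- Htr; unfold mat_tr; lra).
    assert (HA1 : ~ eq_PSL A mat_one).
    { intros [E0|E0]; rewrite E0 in Htr0; unfold mat_tr in Htr0; simpl in Htr0; lra. }
    apply (hyperbolic_of_nontrivial G HG HD HF HC A HA) in HA1.
    rewrite Htr0, Rabs_R0 in HA1. lra.
  - rewrite Hc in DB.
    assert (Ha : m11 B <> 0) by (intros E0; rewrite E0 in DB; lra).
    assert (Hb : m12 B = 0).
    { apply Rmult_integral in Hbd as [Hb|Hd]; [assumption|]. rewrite Hd in DB. lra. }
    assert (EB : B = mat_diag (m11 B)).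
    { apply mat_ext; simpl; try assumption; try reflexivity.
      apply Rmult_eq_reg_l with (m11 B); [|assumption]. rewrite Rinv_r by assumption. lra. }
    rewrite EB in EAN.
    pose proof (axis_translate A N (m11 B) s DA DN Ha EAN) as Et. rewrite E in Et.
    apply axis_param_inj in Et. rewrite Et.
    replace (s + 2 * ln (Rabs (m11 B)) - s) with (2 * ln (Rabs (m11 B))) by ring.
    now apply axis_period_of_diag with A.
Qed.

(** Pairs in the same two cells of length r come from one element up to sign. If their first
    parameters differed, it would carry two points of the axis into the axis, making t - s < l a
    period. *)
Lemma axis_self_intersections l : 0 < l -> (forall l', 0 < l' < l -> ~ axis_period G N l') ->
  exists n, self_intersection_number G (axis N) l n /\ INR n <= (l / r + 1) ^ 2.
Proof.
  intros Hl Hmin.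
  assert (Hlr : 0 <= l / r) by (apply Rdiv_le_0_compat; lra).
  set (K := S (cell (l / r))). destruct (cell_bounds _ Hlr) as [B1 B2].
  assert (HK : INR K = INR (cell (l / r)) + 1) by apply S_INR.
  destruct (finite_by_key (fun p => (cell (fst p / r), cell (snd p / r)))
    (list_prod (seq 0 K) (seq 0 K)) (self_intersection G (axis N) l)) as (ps & Hnd & Hps & Hlen).
  - intros [s t] (H1 & H2 & H3 & _); cbn [fst snd] in *.
    assert (Hin : forall u, 0 <= u < l -> In (cell (u / r)) (seq 0 K)).
    { intros u Hu. apply cell_in_seq. split; [apply Rdiv_le_0_compat; lra|].
      apply Rlt_trans with (l / r); [|lra]. apply Rmult_lt_compat_r; [|lra].
      now apply Rinv_0_lt_compat. }
    apply in_prod; apply Hin; lra.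
  - intros [s t] [s' t'] (H1 & H2 & H3 & A & HA & E) (H1' & H2' & H3' & A' & HA' & E') Ekey.
    cbn [fst snd] in *. injection Ekey as Es Et.
    assert (Hclose : forall u v, 0 <= u -> 0 <= v -> cell (u / r) = cell (v / r) -> Rabs (u - v) < r).
    { intros u v Hu Hv Ec. apply cell_close in Ec; try (apply Rdiv_le_0_compat; lra).
      replace (u / r - v / r) with ((u - v) * / r) in Ec by (field; lra).
      rewrite Rabs_mult, (Rabs_pos_eq (/ r)) in Ec by (left; now apply Rinv_0_lt_compat).
      apply (Rmult_lt_compat_r r) in Ec; [|assumption].
      rewrite Rmult_assoc, Rinv_l in Ec by lra. lra. }
    apply Hclose in Es, Et; try lra.
    assert (EP : eq_PSL (mat_mul A' (mat_inv A)) mat_one)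
      by (apply axis_close_strands with s t s' t'; auto).
    rewrite (mobius_eq_of_eq_PSL A A') in E' by (auto using axis_in_H; now apply (G_det G HG)).
    destruct (Req_dec s s') as [->|Hne].
    + f_equal. apply axis_param_inj. now rewrite E, E'.
    + exfalso. apply (Hmin (t - s)); [lra|].
      now apply axis_two_points with A s' t'.
  - exists (length ps). split; [now exists ps|].
    rewrite length_prod, length_seq in Hlen. apply le_INR in Hlen. rewrite mult_INR in Hlen.
    eapply Rle_trans; [exact Hlen|]. pose proof (pos_INR K).
    replace ((l / r + 1) ^ 2) with ((l / r + 1) * (l / r + 1)) by ring.
    apply Rmult_le_compat; lra.
Qed.

End Counting.

(** * Combining density with the count *)

Theorem corollary1p2 :
  forall (g : nat) (G : mat2 -> Prop),
    (2 <= g)%nat ->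
    closed_hyperbolic_surface g G ->
    exists C_X : R, 0 < C_X /\
      forall eps : R, 0 < eps <= 1 / 2 ->
        exists (c : R -> C) (L : R),
          closed_geodesic G c L /\
          dense_geodesic G eps c /\
          exists n : nat,
            self_intersection_number G c L n /\
            INR n <= C_X * (1 / eps ^ 2) * (ln (1 / eps)) ^ 2.
Proof.
  intros g G _ (HG & HD & HF & HC & _).
  destruct (injectivity_radius G HG HD HF HC) as (rho & Hrho & Hinj).
  (* This makes (2 sinh r)^2 = rho / 4, strictly below rho, as the counting uses a non-strict bound
     on displacements. *)
  set (r := arcsinh (sqrt rho / 4)).
  assert (Hsq : 0 < sqrt rho) by now apply sqrt_lt_R0.
  assert (Hr : 0 < r).
  { rewrite <- arcsinh_0. apply arcsinh_lt. lra. }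
  assert (Hr2 : (2 * sinh r) ^ 2 < rho).
  { unfold r. rewrite sinh_arcsinh. pose proof (sqrt_sqrt rho). nra. }
  assert (Hinj' : forall A z, G A -> in_H z -> sep z (mobius A z) <= (2 * sinh r) ^ 2 ->
    eq_PSL A mat_one).
  { intros A z HA Hz Hs. apply Hinj with z; auto. lra. }
  destruct (dense_axis G HG HD HF HC) as (C1 & HC1 & Hdense).
  assert (Hln2 : 0 < ln 2) by (rewrite <- ln_1; apply ln_increasing; lra).
  assert (HC1r : 0 < C1 / r) by (now apply Rdiv_lt_0_compat).
  assert (Hi2 : 0 < / ln 2) by now apply Rinv_0_lt_compat.
  (* The count is (L / r + 1)^2; as (1 / eps) ln (1 / eps) >= ln 2, the term / ln 2 absorbs the
     1. *)
  exists ((C1 / r + / ln 2) ^ 2). split; [apply pow_lt; lra|].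
  intros eps Heps.
  destruct (Hdense eps Heps) as (N & P & x & DN & HP & Hx & EP & Hlen & Hd).
  assert (Hx0 : x <> 0) by (intros E; rewrite E, Rabs_R0 in Hx; lra).
  assert (Hlnx : 0 < ln (Rabs x)) by (rewrite <- ln_1; apply ln_increasing; lra).
  destruct (minimal_axis_period G HG r Hr Hinj' N DN (2 * ln (Rabs x))) as (L & HL & HpL & Hmin);
    [lra|now apply axis_period_of_diag with P|].
  exists (axis N), L. split; [|split].
  - split; [intros t; now apply axis_in_H|]. split; [intros; now apply axis_unit_speed|].
    split; [tauto|]. intros t.
    destruct (axis_period_mobius G HG N DN L HpL) as (A & HA & HAt).
    (* [same_point] asks for an element taking the point at t + L back to the one at t. *)
    exists (mat_inv A). split; [now apply (G_inv G HG)|].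
    rewrite <- HAt. symmetry. apply mobius_inv_l; [now apply (G_det G HG)|now apply axis_in_H].
  - intros z Hz. destruct (Hd z Hz) as (A & t & HA & Hs).
    apply Rle_trans with (dist_X G z (axis N t)).
    + apply Glb_le; [|now exists t]. intros s (t' & ->).
      apply (dist_X_nonneg G HG); auto using axis_in_H.
    + eapply Rle_trans; [apply (dist_X_le G HG z (axis N t) A); auto using axis_in_H|].
      apply dist_H_le_of_sep; auto; [|lra].
      apply mobius_in_H; [now apply (G_det G HG)|now apply axis_in_H].
  - destruct (axis_self_intersections G HG HD HF HC r Hr Hinj' N DN L) as (n & Hn & Hnb); [tauto|auto|].
    exists n. split; [exact Hn|]. eapply Rle_trans; [exact Hnb|].
    set (u := 1 / eps * ln (1 / eps)).
    replace (_ * _ * _) with (((C1 / r + / ln 2) * u) ^ 2) by (unfold u; field; lra).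
    assert (Hlr : 0 <= L / r) by (apply Rdiv_le_0_compat; lra).
    apply pow_incr. split; [lra|].
    assert (Hu1 : L / r <= C1 / r * u).
    { replace (C1 / r * u) with (C1 * (1 / eps) * ln (1 / eps) / r) by (unfold u; field; lra).
      apply Rmult_le_compat_r; [left; now apply Rinv_0_lt_compat|lra]. }
    assert (Hu2 : ln 2 <= u).
    { assert (Hie : 2 <= 1 / eps) by (apply Rle_div_r; lra).
      assert (ln 2 <= ln (1 / eps)) by (apply ln_le; lra).
      unfold u. nra. }
    assert (1 <= / ln 2 * u).
    { rewrite <- (Rinv_l (ln 2)) by lra. apply Rmult_le_compat_l; lra. }
    lra.
Qed.
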